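(* There is a universal constant $c>0$, independent of the dimension $n$ and the volume $\varepsilon$, such that for every $n\ge2$ and every $\varepsilon\in(0,\frac12)$, any two bodies $A$ and $B$ of volume $\varepsilon$ inside the unit-volume simplex $\omega_n\Delta_n$ are at a distance at most $$-c\ln\varepsilon.$$
   Context: $\mathbb{R}_+=(0,+\infty)$ and $\Delta_n=\{(x_1,\dots,x_n)\in\mathbb{R}_+^n : x_1+\dots+x_n=1\}$, whose $(n-1)$-dimensional volume is $\frac{n\sqrt n}{n!}$; $\omega_n=\left(\frac{n!}{n\sqrt n}\right)^{\frac1{n-1}}$, so that $\omega_n\Delta_n$ has $(n-1)$-dimensional volume $1$. Bodies are measurable subsets of $\omega_n\Delta_n$; volume is $(n-1)$-dimensional Lebesgue measure. The distance between non-empty sets is $\operatorname{dist}(A,B)=\inf_{x\in A,\,y\in B}\|x-y\|_2$ (Euclidean distance). *)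

(* Defs.v *)
From HB Require Import structures.
From mathcomp Require Import all_boot all_order all_algebra.
From mathcomp Require Import all_classical all_reals all_analysis.

Set Implicit Arguments.
Unset Strict Implicit.
Unset Printing Implicit Defensive.

Import Order.TTheory GRing.Theory Num.Theory.
Import numFieldNormedType.Exports.

Local Open Scope classical_set_scope.
Local Open Scope ring_scope.

Definition tcons {T : Type} {n : nat} (p : T * n.-tuple T) : n.+1.-tuple T :=
  [tuple of p.1 :: p.2].

Lemma measurable_tcons d (T : measurableType d) n :
  measurable_fun setT (@tcons T n).
Proof. exact: measurable_cons. Qed.

(* Not inferred: the canonical sigma-finite structure on products is the one for
   pairs of subprobabilities. *)
Lemma sigma_finite_product d1 d2 (T1 : measurableType d1)
    (T2 : measurableType d2) (R : realType)
    (m1 : {sigma_finite_measure set T1 -> \bar R})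
    (m2 : {sigma_finite_measure set T2 -> \bar R}) :
  sigma_finite setT (m1 \x m2)%E.
Proof.
have /sigma_finiteP[F [TF ndF Foo]] := sigma_finiteT m1.
have /sigma_finiteP[G [TG ndG Goo]] := sigma_finiteT m2.
exists (fun n => F n `*` G n).
  rewrite -setXTT TF TG predeqE => -[x y]; split.
    move=> [/= [n _ Fnx] [k _ Gky]]; exists (maxn n k) => //; split.
    - by move: x Fnx; exact/subsetPset/ndF/leq_maxl.
    - by move: y Gky; exact/subsetPset/ndG/leq_maxr.
  by move=> [n _ []/= ? ?]; split; exists n.
move=> k; have [? ?] := Foo k; have [? ?] := Goo k.
split; first exact: measurableX.
by rewrite product_measure1E// lte_mul_pinfty// ge0_fin_numE.
Qed.

Section tuple_measure.
Context d (T : measurableType d) (R : realType).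
Variable m : {sigma_finite_measure set T -> \bar R}.

Section succ.
Variables (n : nat) (mu : {sigma_finite_measure set (n.-tuple T) -> \bar R}).

Definition tuple_measure_succ : set (n.+1.-tuple T) -> \bar R :=
  pushforward (m \x mu)%E tcons.

Let succ0 : tuple_measure_succ set0 = 0%E.
Proof. by rewrite /tuple_measure_succ /pushforward preimage_set0 measure0. Qed.

Let succ_ge0 A : (0 <= tuple_measure_succ A)%E.
Proof. by apply: integral_ge0 => x _; exact: measure_ge0. Qed.

Let succ_sigma_additive : semi_sigma_additive tuple_measure_succ.
Proof.
move=> F mF tF mUF; rewrite /tuple_measure_succ /pushforward preimage_bigcup.
apply: measure_semi_sigma_additive.
- by move=> k; rewrite -[X in measurable X]setTI; exact: measurable_tcons.
- apply/trivIsetP => /= i j _ _ ij; rewrite -preimage_setI.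
  by move/trivIsetP : tF => /(_ _ _ _ _ ij) ->//; rewrite preimage_set0.
- rewrite -preimage_bigcup -[X in measurable X]setTI.
  exact: measurable_tcons.
Qed.

HB.instance Definition _ := isMeasure.Build _ _ _ tuple_measure_succ
  succ0 succ_ge0 succ_sigma_additive.

Let succ_sigma_finite : sigma_finite setT tuple_measure_succ.
Proof.
have [F TF Foo] := sigma_finite_product m mu.
pose g (t : n.+1.-tuple T) : T * n.-tuple T := (thead t, [tuple of behead t]).
have mg : measurable_fun setT g.
  apply/measurable_fun_pairP; split; first exact: measurable_tnth.
  exact: measurable_behead.
have gK : cancel tcons g.
  by case=> x t; rewrite /g /tcons /thead tnth0; congr pair; exact: val_inj.
exists (fun k => g @^-1` F k); first by rewrite -preimage_bigcup -TF preimage_setT.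
move=> k; have [mF Fk] := Foo k; split.
  by rewrite -[X in measurable X]setTI; exact: mg.
rewrite /= /tuple_measure_succ /pushforward -comp_preimage.
by rewrite (_ : g \o tcons = id)//; apply/funext => x; exact: gK.
Qed.

HB.instance Definition _ := Measure_isSigmaFinite.Build _ _ _ tuple_measure_succ
  succ_sigma_finite.

End succ.

(* The n-fold product of m with itself, on the product sigma-algebra. *)
Fixpoint tuple_measure n : {sigma_finite_measure set (n.-tuple T) -> \bar R} :=
  match n with
  | 0 => @dirac _ (0.-tuple T) [tuple] R
  | n.+1 => tuple_measure_succ (tuple_measure n)
  end.

End tuple_measure.

Section simplex_volume.
Context {R : realType}.

Definition lebesgue_tuple k :
    {sigma_finite_measure set (k.-tuple (measurableTypeR R)) -> \bar R} :=
  tuple_measure lebesgue_measure k.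

(* The sigma-algebra of lebesgue_tuple k is the Borel one. The outer measure
   (lebesgue_tuple k)^* and its Caratheodory-measurable sets are the completion,
   that is, Lebesgue measure on all Lebesgue measurable subsets of R^k. *)
Definition lebesgue_outer k : set (k.-tuple (measurableTypeR R)) -> \bar R :=
  ((lebesgue_tuple k)^*)%mu.
Arguments lebesgue_outer k : clear implicits.

Definition flat_param k n (p : 'rV[R]_n) (J : 'M[R]_(k, n))
    (t : k.-tuple (measurableTypeR R)) : 'rV[R]_n :=
  p + (\row_(i < k) (tnth t i : R)) *m J.

(* For row-free J, flat_param p J is a bijection onto the k-dimensional flat
   through p directed by the rows of J; it multiplies k-dimensional volume by
   the square root of the Gram determinant of these rows. The next two notions
   thus are Lebesgue measurability and k-dimensional Lebesgue measure on that
   flat (for its Euclidean structure inherited from R^n), whatever the choice of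
   the parametrization p, J. *)
Definition flat_measurable k n (p : 'rV[R]_n) (J : 'M[R]_(k, n))
    (A : set 'rV[R]_n) : Prop :=
  (lebesgue_outer k).-caratheodory (flat_param p J @^-1` A).

Definition flat_volume k n (p : 'rV[R]_n) (J : 'M[R]_(k, n))
    (A : set 'rV[R]_n) : \bar R :=
  ((Num.sqrt (\det (J *m J^T)))%:E * lebesgue_outer k (flat_param p J @^-1` A))%E.

Definition std_simplex n : set 'rV[R]_n :=
  [set x | (forall i, 0 < x 0 i) /\ \sum_i x 0 i = 1].
Arguments std_simplex n : clear implicits.

Definition omega n : R :=
  (n`!%:R / (n%:R * Num.sqrt n%:R)) `^ (n.-1%:R^-1).

Definition unit_simplex n : set 'rV[R]_n :=
  [set omega n *: x | x in std_simplex n].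
Arguments unit_simplex n : clear implicits.

(* With e_0, ..., e_(n-1) the standard basis: the vertex omega n *: e_(n-1) of
   the closed simplex, and the edge directions e_i - e_(n-1) for i < n-1. They
   parametrize the hyperplane of vectors with coordinate sum omega n. *)
Definition simplex_vertex n : 'rV[R]_n :=
  \row_j (omega n * (j == n.-1 :> nat)%:R).

Definition simplex_frame n : 'M[R]_(n.-1, n) :=
  \matrix_(i, j) ((j == i :> nat)%:R - (j == n.-1 :> nat)%:R).

Definition body n (A : set 'rV[R]_n) : Prop :=
  A `<=` unit_simplex n /\
  flat_measurable (simplex_vertex n) (simplex_frame n) A.

Definition volume n (A : set 'rV[R]_n) : \bar R :=
  flat_volume (simplex_vertex n) (simplex_frame n) A.

Definition eucl_norm n (x : 'rV[R]_n) : R := Num.sqrt (\sum_i x 0 i ^+ 2).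

Definition eucl_dist n (A B : set 'rV[R]_n) : R :=
  inf [set eucl_norm (x - y) | x in A & y in B].

End simplex_volume.

Arguments lebesgue_outer {R} k _.
Arguments std_simplex {R} n _.
Arguments unit_simplex {R} n _.

(* Main.v *)
Require Import Defs.
From mathcomp Require Import all_boot all_order all_algebra.
From mathcomp Require Import all_classical all_reals all_analysis.
From mathcomp Require Import measurable_realfun ring lra.
Import Order.TTheory GRing.Theory Num.Theory.
Import numFieldNormedType.Exports.
Local Open Scope classical_set_scope.
Local Open Scope ring_scope.

(** The unit-volume simplex in dimension n has edge length of order n, and a
    uniform random point of it is distributed as omega * u / s, where u is a
    vector of n independent exponential variables and s is the sum of its
    coordinates. The theorem thus reduces to the concentration of the product
    exponential measure, provided that dividing by s does no harm.

    Concentration is obtained from Maurey's property (tau) in a form that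
    involves no inf-convolution: if f and g are nonnegative and
    f u * g v <= expR (sum of theta (u_i - v_i)) for all u and v, then the product
    of the integrals of f and g against the exponential measure is at most 1.
    Here theta d = (sqrt (1 + d^2) - 1) / 16 is quadratic near 0 and linear at
    infinity. Phrased this way, the property tensorizes by the Tonelli theorem
    alone (tuple_coupling_integral_prod_le1), and only dimension one requires an
    argument (coupling_integral_prod_le1): the functions may be replaced by their
    envelopes, which are continuous, and for these a maximum principle applied
    to the product of the two distribution functions does the work of a
    monotone transport (primitive_prod_le1). Applied to indicator functions, the
    property yields points u and v, in any two sets X and Y of probabilities P
    and P', with sum of theta (u_i - v_i) at most - ln (P * P'), up to an
    arbitrarily small loss (expprob_concentration).

    The cone over a body of volume eps, truncated to s >= n / 4, has probability
    of order eps (body_cone): in the coordinates given by s and the direction,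
    the exponential measure is a Gamma measure times the uniform measure of the
    simplex. Two such cones contain u and v of total cost at most a multiple of
    L = - ln eps. Then |u - v| is of order L, the two sums differ by at most
    order sqrt (n * L), and normalizing u and v moves them relatively to each
    other by at most order sqrt (L / n) * |v|. Concentration once more, around the
    ball of radius 2 * sqrt n, allows |v| to be taken of order sqrt n + L. For
    L <= n the distance is thus of order L (normalized_dist_le), and for L >= n
    the diameter of the simplex, at most 2 * n, suffices. *)

(** * The two-level cost *)

Section cost.
Context {R : realType}.
Implicit Types d x y : R.

(** Quadratic near the origin, as for a Gaussian measure, and linear at infinity,
    which is the most that an exponential tail allows. The factor 1/16 is small
    enough for expRN_theta. *)
Definition theta d : R := (Num.sqrt (1 + d ^+ 2) - 1) / 16.

Definition dtheta d : R := d / (16 * Num.sqrt (1 + d ^+ 2)).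

Let w_gt0 d : 0 < 1 + d ^+ 2.
Proof. by rewrite ltr_wpDr// sqr_ge0. Qed.

Let sqrt_ge1 d : 1 <= Num.sqrt (1 + d ^+ 2).
Proof. by rewrite -[leLHS]sqrtr1 ler_wsqrtr// lerDl sqr_ge0. Qed.

Lemma thetaN d : theta (- d) = theta d.
Proof. by rewrite /theta sqrrN. Qed.

Lemma theta_ge0 d : 0 <= theta d.
Proof. by rewrite /theta divr_ge0// subr_ge0. Qed.

(** With e := 16 * theta d this reads d ^+ 2 = e ^+ 2 + 2 * e, the form in which
    the cost controls Euclidean quantities. *)
Lemma theta_sqrt d : (16 * theta d + 1) ^+ 2 = 1 + d ^+ 2.
Proof.
by rewrite /theta mulrC divfK// subrK sqr_sqrtr// ltW.
Qed.

Lemma is_derive_theta d : is_derive d 1 theta (dtheta d).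
Proof.
have -> : dtheta d = ((2 * Num.sqrt (1 + d ^+ 2))^-1 * (2 * d)) / 16.
  have s0 : Num.sqrt (1 + d ^+ 2) != 0.
    by rewrite gt_eqF// (lt_le_trans ltr01).
  by rewrite /dtheta; field.
have H : is_derive d 1 (Num.sqrt \o (fun d : R => 1 + d ^+ 2))
   ((2 * Num.sqrt (1 + d ^+ 2))^-1 * (2 * d)).
  apply: is_derive1_comp; first exact: is_derive1_sqrt.
  by apply: is_derive_eq; rewrite add0r; rewrite /GRing.scale /= mulr1; ring.
have -> : theta = (16^-1 : R) \*: ((Num.sqrt \o (fun d : R => 1 + d ^+ 2)) - cst 1).
  apply/funext => t; by rewrite /theta mulrC.
apply: is_derive_eq; rewrite subr0.
exact: mulrC.
Qed.

Lemma dtheta_le x : `|dtheta x| <= 16^-1.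
Proof.
rewrite /dtheta normrM normfV (ger0_norm (_ : 0 <= 16 * _)) ?mulr_ge0 ?sqrtr_ge0//.
rewrite invfM mulrCA ler_piMr ?invr_ge0//.
rewrite ler_pdivrMr ?(lt_le_trans ltr01)// mul1r.
by rewrite -sqrtr_sqr ler_wsqrtr// lerDr.
Qed.

Lemma theta_lipschitz x y : `|theta x - theta y| <= 16^-1 * `|x - y|.
Proof.
wlog xy : x y / y <= x.
  move=> H; case: (leP y x) => [/H//|/ltW/H].
  by rewrite distrC (distrC x).
move: xy; rewrite le_eqVlt => /predU1P[->|yx].
  by rewrite !subrr normr0 mulr0.
have [z _ ->] := @MVT R theta dtheta y x yx (fun z _ => is_derive_theta z)
  (continuous_subspaceT (fun z => differentiable_continuous
    (proj1 (derivable1_diffP _ _) (@ex_derive _ _ _ _ _ _ _ (is_derive_theta z))))).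
by rewrite normrM ler_wpM2r// dtheta_le.
Qed.

(** The differential inequality that makes theta an admissible cost. Writing
    w = sqrt(1 + d^2), the bound expR theta >= 1 + theta turns it into the
    polynomial inequality (w + 1) * (w + 15) <= 64 * w^2, valid for w >= 1. *)
Lemma expRN_theta d : expR (- theta d) <= 1 - 4 * dtheta d ^+ 2.
Proof.
set w := Num.sqrt (1 + d ^+ 2).
have w1 : 1 <= w by exact: sqrt_ge1.
have w0 : 0 < w by exact: lt_le_trans w1.
have dE : d ^+ 2 = w ^+ 2 - 1 by rewrite /w sqr_sqrtr ?ltW// addrC addKr.
have -> : 4 * dtheta d ^+ 2 = (w ^+ 2 - 1) / (64 * w ^+ 2).
  by rewrite /dtheta -/w exprMn dE; field; rewrite gt_eqF.
have t0 := theta_ge0 d.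
have t1 : 0 < 1 + theta d by rewrite ltr_wpDr.
rewrite expRN; apply: (@le_trans _ _ (1 + theta d)^-1).
  by rewrite lef_pV2 ?posrE ?expR_gt0// expR_ge1Dx.
have -> : theta d = (w - 1) / 16 by [].
have h : 0 < w + 15 by rewrite ltr_wpDl// ltW.
have -> : (1 + (w - 1) / 16)^-1 = 16 / (w + 15).
  by rewrite (_ : 1 + _ = (w + 15) / 16) ?invf_div//; field.
rewrite ler_pdivrMr// -subr_ge0.
have -> : (1 - (w ^+ 2 - 1) / (64 * w ^+ 2)) * (w + 15) - 16 =
   (w - 1) * (64 * w ^+ 2 - (w + 1) * (w + 15)) / (64 * w ^+ 2).
  by field; rewrite gt_eqF.
rewrite divr_ge0//; last by rewrite mulr_ge0 ?sqr_ge0.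
rewrite mulr_ge0 ?subr_ge0//; nra.
Qed.

End cost.

(** * One-sided derivative at a maximum *)

Section left_max.
Context {R : realType}.

(** A maximum on a box may lie on its upper boundary, where only the left
    difference quotients have a known sign. *)
Lemma left_max_derive_ge0 (f : R -> R) (a c d : R) : a < c ->
  is_derive c 1 f d -> (forall x, a < x < c -> f x <= f c) -> 0 <= d.
Proof.
move=> ac [/cvg_dnbhs_at_left dfc <-] cmax.
rewrite /derive -(cvg_lim _ dfc)//.
apply: limr_ge; first by apply: cvgP dfc.
have ac0 : a - c < 0 by rewrite subr_lt0.
near=> h; have h0 : h < 0 by near: h; exact: nbhs_left_lt.
have ah : a < h + c by rewrite -ltrBlDr; near: h; exact: nbhs_left_gt.
rewrite /= [h *: 1]mulr1 mulr_le0 ?invr_le0 ?(ltW h0)// subr_le0.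
by rewrite cmax// ah gtrDr.
Unshelve. all: by end_near. Qed.

End left_max.

(** * A maximum principle for products of primitives *)

Section maximum_principle.
Context {R : realType}.
Implicit Types x y : R.

(** The midpoint lowered by the cost. In a transport proof x and y are matched
    quantiles of two densities and tmean x y is the point of the reference
    exponential measure to which the pair is sent. *)
Definition tmean x y : R := (x + y) / 2 - theta (x - y).

(** theta has slope at most 1/16, so the cost never exceeds half of x + y. *)
Lemma tmean_ge0 x y : 0 <= x -> 0 <= y -> 0 <= tmean x y.
Proof.
move=> x0 y0; rewrite subr_ge0.
have := theta_lipschitz (x - y) 0.
have -> : theta (0 : R) = 0 by rewrite /theta expr0n/= addr0 sqrtr1 subrr mul0r.
rewrite !subr0 ger0_norm ?theta_ge0// => /le_trans; apply.
have : `|x - y| <= x + y by rewrite ler_norml; apply/andP; split; lra.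
lra.
Qed.

Lemma is_derive_tmean_l x y :
  is_derive x 1 (tmean^~ y) (1 / 2 - dtheta (x - y)).
Proof.
have H : is_derive x 1 (theta \o (fun x => x - y)) (dtheta (x - y) * 1).
  apply: is_derive1_comp; first exact: is_derive_theta.
  by apply: is_derive_eq; rewrite subr0.
have -> : tmean^~ y = (fun x => (x + y) * 2^-1) - (theta \o (fun x => x - y)).
  by [].
apply: is_derive_eq; rewrite /GRing.scale/=; lra.
Qed.

Lemma is_derive_tmean_r x y :
  is_derive y 1 (tmean x) (1 / 2 + dtheta (x - y)).
Proof.
have H : is_derive y 1 (theta \o (fun y => x - y)) (dtheta (x - y) * -1).
  apply: is_derive1_comp; first exact: is_derive_theta.
  by apply: is_derive_eq; rewrite add0r mul1r.
have -> : tmean x = (fun y => (x + y) * 2^-1) - (theta \o (fun y => x - y)).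
  by [].
apply: is_derive_eq; rewrite /GRing.scale/=; lra.
Qed.

Variables (q p F G : R -> R).
Hypothesis dF : forall x, 0 <= x -> is_derive x 1 F (q x * expR (- x)).
Hypothesis dG : forall x, 0 <= x -> is_derive x 1 G (p x * expR (- x)).
Hypotheses (F00 : F 0 = 0) (G00 : G 0 = 0).
Hypothesis qp : forall x y, q x * p y <= expR (theta (x - y)).

Let cvgF x : 0 <= x -> {for x, continuous F}.
Proof.
move=> x0; apply: differentiable_continuous; apply/derivable1_diffP.
by have ? := dF _ x0; exact: ex_derive.
Qed.

Let cvgG x : 0 <= x -> {for x, continuous G}.
Proof.
move=> x0; apply: differentiable_continuous; apply/derivable1_diffP.
by have ? := dG _ x0; exact: ex_derive.
Qed.

Let ctheta : continuous (@theta R).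
Proof.
move=> x; apply: differentiable_continuous; apply/derivable1_diffP.
by have ? := is_derive_theta x; exact: ex_derive.
Qed.

Let k (eta x y : R) := 1 + eta - expR (- tmean x y).

Let dk (eta : R) (f : R -> R) (x df : R) : is_derive x 1 f df ->
  is_derive x 1 (fun x => (1 + eta - expR (- f x)) ^+ 2)
   (2 * (1 + eta - expR (- f x)) * (expR (- f x) * df)).
Proof.
move=> Df.
have H : is_derive x 1 (expR \o - f) (expR (- f x) * - df).
  by apply: is_derive1_comp.
have -> : (fun x => (1 + eta - expR (- f x)) ^+ 2) =
  (cst (1 + eta) - (expR \o - f)) ^+ 2 by [].
apply: is_derive_eq; rewrite /GRing.scale/= !fctE/= /cst; ring.
Qed.

(** Let K x y := 1 - expR (- tmean x y) <= 1, the exponential measure of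
    [0, tmean x y]. The claim follows from F x * G y <= K x y ^+ 2, up to an
    arbitrarily small eta that keeps the denominator away from 0 at the origin.
    At a maximum point (x, y) of the ratio m := F x * G y / (K x y + eta) ^+ 2,
    both partial derivatives are nonnegative; multiplying these two
    inequalities gives 4 * m * K_x * K_y <= q x * p y * expR (- x - y), where
    K_x * K_y = expR (- 2 * tmean x y) * (1/4 - dtheta (x - y) ^+ 2). By qp and
    expRN_theta this forces m <= 1. No inverse function, hence no transport
    map, has to be constructed. *)
Lemma primitive_prod_le1 (M N : R) : 0 <= M -> 0 <= N -> F M * G N <= 1.
Proof.
move=> M0 N0; rewrite leNgt; apply/negP => FG1.
(* eta is small enough that (1 + eta) ^+ 2 stays below the alleged value. *)
have [eta eta0 FGeta] : exists2 eta : R, 0 < eta & (1 + eta) ^+ 2 < F M * G N.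
  exists (Num.min 1 ((F M * G N - 1) / 4)).
    by rewrite lt_min ltr01 divr_gt0// subr_gt0.
  set e := Num.min _ _.
  have e1 : e <= 1 by rewrite ge_min lexx.
  have e2 : e <= (F M * G N - 1) / 4 by rewrite ge_min lexx orbT.
  have e0 : 0 < e by rewrite lt_min ltr01 divr_gt0// subr_gt0.
  nra.
have k_gt0 x y : 0 <= x -> 0 <= y -> 0 < k eta x y.
  move=> x0 y0; rewrite /k addrAC ltr_wpDl// subr_ge0 -expR0 ler_expR.
  by rewrite oppr_le0 tmean_ge0.
have k_le x y : k eta x y <= 1 + eta by rewrite /k gerBl expR_ge0.
pose H (z : R * R) := F z.1 * G z.2 / k eta z.1 z.2 ^+ 2.
have [] := @compact_EVT_max (R * R)%type R H (`[0, M] `*` `[0, N]).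
- by exists (0, 0); split => /=; rewrite in_itv/= lexx.
- by apply: compact_setX; exact: segment_compact.
- apply: continuous_in_subspaceT => -[x y]; rewrite inE => -[/=].
  rewrite !in_itv/= => /andP[x0 _] /andP[y0 _].
  apply: cvgM.
    apply: cvgM.
      by apply: (@continuous_comp _ _ _ fst F); [exact: cvg_fst|exact: cvgF].
    by apply: (@continuous_comp _ _ _ snd G); [exact: cvg_snd|exact: cvgG].
  apply: cvgV; first by rewrite expf_neq0// gt_eqF// k_gt0.
  apply: (@continuous_comp _ _ _ (fun z : R * R => k eta z.1 z.2)
    (fun t : R => t ^+ 2)); last exact: exprn_continuous.
  apply: cvgB; first exact: cvg_cst.
  apply: (@continuous_comp _ _ _ (fun z : R * R => - tmean z.1 z.2) expR);
    last exact: continuous_expR.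
  apply: cvgN; apply: cvgB.
    by apply: cvgMl; apply: cvgD; [exact: cvg_fst|exact: cvg_snd].
  apply: (@continuous_comp _ _ _ (fun z : R * R => z.1 - z.2) theta);
    last exact: ctheta.
  by apply: cvgB; [exact: cvg_fst|exact: cvg_snd].
move=> [x y]; rewrite inE => -[/=]; rewrite !in_itv/=.
move=> /andP[x0 xM] /andP[y0 yN] Hmax.
set m := H (x, y) in Hmax.
have m_gt1 : 1 < m.
  have : H (M, N) <= m.
    by apply: Hmax; rewrite inE; split; rewrite /= in_itv/= ?M0 ?N0 lexx.
  apply: lt_le_trans; rewrite /H/= ltr_pdivlMr ?exprn_gt0 ?k_gt0// mul1r.
  apply: le_lt_trans FGeta.
  by rewrite ler_sqr ?nnegrE ?(ltW (k_gt0 _ _ M0 N0)) ?addr_ge0 ?(ltW eta0).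
have K0 := k_gt0 _ _ x0 y0.
have Hle s t : 0 <= s <= M -> 0 <= t <= N -> F s * G t <= m * k eta s t ^+ 2.
  move=> sM tN; have : H (s, t) <= m by apply: Hmax; rewrite inE; split.
  rewrite /H/= ler_pdivrMr// exprn_gt0// k_gt0//.
    by case/andP: sM.
  by case/andP: tN.
have Hxy : F x * G y = m * k eta x y ^+ 2.
  by rewrite /m /H/= divfK// expf_neq0// gt_eqF.
have FGxy : 0 < F x * G y.
  by rewrite Hxy mulr_gt0 ?exprn_gt0// (lt_trans ltr01).
have x_gt0 : 0 < x.
  by rewrite lt_neqAle x0 andbT; apply/eqP => xE; rewrite -xE F00 mul0r ltxx in FGxy.
have y_gt0 : 0 < y.
  by rewrite lt_neqAle y0 andbT; apply/eqP => xE; rewrite -xE G00 mulr0 ltxx in FGxy.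
have Dx : 0 <= q x * expR (- x) * G y - m * (2 * k eta x y *
    (expR (- tmean x y) * (1 / 2 - dtheta (x - y)))).
  apply: (@left_max_derive_ge0 _ (fun s => F s * G y - m * k eta s y ^+ 2) 0 x).
  - exact: x_gt0.
  - have ? := dF _ x0; have ? := dk eta _ _ _ (is_derive_tmean_l x y).
    have -> : (fun s => F s * G y - m * k eta s y ^+ 2) =
       (G y \*: F) - (m \*: (fun s => (1 + eta - expR (- tmean s y)) ^+ 2)).
      by apply/funext => s; rewrite mulrC.
    by apply: is_derive_eq; rewrite /GRing.scale/= [X in X - _]mulrC.
  - move=> s /andP[s0 sx]; rewrite Hxy subrr subr_le0 Hle ?y0//.
    by rewrite (ltW s0) (le_trans (ltW sx)).
have Dy : 0 <= p y * expR (- y) * F x - m * (2 * k eta x y *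
    (expR (- tmean x y) * (1 / 2 + dtheta (x - y)))).
  apply: (@left_max_derive_ge0 _ (fun s => F x * G s - m * k eta x s ^+ 2) 0 y).
  - exact: y_gt0.
  - have ? := dG _ y0; have ? := dk eta _ _ _ (is_derive_tmean_r x y).
    have -> : (fun s => F x * G s - m * k eta x s ^+ 2) =
       (F x \*: G) - (m \*: (fun s => (1 + eta - expR (- tmean x s)) ^+ 2)).
      by [].
    by apply: is_derive_eq; rewrite /GRing.scale/= [X in X - _]mulrC.
  - move=> s /andP[s0 sx]; rewrite Hxy subrr subr_le0 Hle ?x0//.
    by rewrite (ltW s0) (le_trans (ltW sx)).
have dl := dtheta_le (x - y).
move: Dx Dy; rewrite !subr_ge0.
set K := k eta x y in K0 Hxy *; set Z := expR _; set D := dtheta _ in dl *.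
have Z0 : 0 < Z by exact: expR_gt0.
have m0 : 0 < m by exact: lt_trans m_gt1.
have D1 : 0 < 1 / 2 - D by move: dl; rewrite ler_norml => /andP[]; lra.
have D2 : 0 < 1 / 2 + D by move: dl; rewrite ler_norml => /andP[]; lra.
(* Multiply the two first-order conditions; F x * G y = m * K ^+ 2 cancels. *)
clearbody m; move=> Dx Dy.
have E1 : 0 <= m * (2 * K * (Z * (1 / 2 - D))).
  by rewrite ltW// !mulr_gt0.
have E2 : 0 <= m * (2 * K * (Z * (1 / 2 + D))).
  by rewrite ltW// !mulr_gt0.
have := ler_pM E1 E2 Dx Dy.
have -> : q x * expR (- x) * G y * (p y * expR (- y) * F x) =
  (m * K ^+ 2) * (q x * p y * (expR (- x) * expR (- y))).
  by rewrite -Hxy; ring.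
have -> : m * (2 * K * (Z * (1 / 2 - D))) * (m * (2 * K * (Z * (1 / 2 + D)))) =
  (m * K ^+ 2) * (m * (Z ^+ 2 * (1 - 4 * D ^+ 2))).
  by field.
rewrite ler_pM2l ?mulr_gt0 ?exprn_gt0// leNgt => /negP; apply.
apply: (@le_lt_trans _ _ (expR (theta (x - y)) * (expR (- x) * expR (- y)))).
  by rewrite ler_wpM2r ?mulr_ge0 ?expR_ge0.
apply: (@lt_le_trans _ _ (m * (expR (theta (x - y)) * (expR (- x) * expR (- y))))).
  by rewrite ltr_pMl ?mulr_gt0 ?expR_gt0.
rewrite ler_pM2l//.
have -> : expR (theta (x - y)) * (expR (- x) * expR (- y)) =
    Z ^+ 2 * expR (- theta (x - y)).
  by rewrite expr2 -!expRD; congr expR; rewrite /tmean; lra.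
by rewrite ler_pM2l ?exprn_gt0// expRN_theta.
Qed.

End maximum_principle.

(** * Inf-convolution in multiplicative form *)

Section envelope.
Context {R : realType}.
Variables (D : set R) (h : R -> R).
Hypotheses (D0 : D !=set0) (h0 : forall x, D x -> 0 < h x).

(** The largest p with h x * p y <= expR (theta (x - y)) for all x in D. It
    inherits the Lipschitz bound of theta on the logarithmic scale, so two such
    replacements turn arbitrary functions into continuous ones that are at
    least as large. *)
Definition envelope (y : R) : R :=
  inf [set expR (theta (x - y)) / h x | x in D].

Let lb0 y : has_lbound [set expR (theta (x - y)) / h x | x in D].
Proof.
by exists 0 => _ [x Dx <-]; rewrite divr_ge0 ?expR_ge0 ?ltW ?h0.
Qed.

Let ne y : [set expR (theta (x - y)) / h x | x in D] !=set0.
Proof. by have [x Dx] := D0; exists (expR (theta (x - y)) / h x), x. Qed.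

Lemma envelope_mul x y : D x -> h x * envelope y <= expR (theta (x - y)).
Proof.
move=> Dx; rewrite mulrC -ler_pdivlMr ?h0//.
by apply: ge_inf => //; exists x.
Qed.

Lemma le_envelope c y :
  (forall x, D x -> c * h x <= expR (theta (x - y))) -> c <= envelope y.
Proof.
move=> H; apply: lb_le_inf; first exact: ne.
by move=> _ [x Dx <-]; rewrite ler_pdivlMr ?h0// H.
Qed.

Lemma envelope_ge0 y : 0 <= envelope y.
Proof. by apply: le_envelope => x Dx; rewrite mul0r expR_ge0. Qed.

Lemma envelope_lipschitz y z :
  envelope y <= expR (16^-1 * `|y - z|) * envelope z.
Proof.
rewrite -ler_pdivrMl ?expR_gt0//; apply: le_envelope => x Dx.
rewrite -mulrA ler_pdivrMl ?expR_gt0// -expRD mulrC.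
apply: (le_trans (envelope_mul _ _ Dx)); rewrite ler_expR.
have := theta_lipschitz (x - y) (x - z).
have -> : x - y - (x - z) = - (y - z) by ring.
by rewrite normrN ler_norml => /andP[_]; rewrite lerBlDr.
Qed.

Lemma envelope_gt0 y z : 0 < envelope z -> 0 < envelope y.
Proof.
move=> z0; have := envelope_lipschitz z y.
by move/(lt_le_trans z0); rewrite pmulr_rgt0// expR_gt0.
Qed.

Lemma continuous_envelope : continuous envelope.
Proof.
move=> z.
have cvge (s : R) : expR (s * `|y - z|) * envelope z @[y --> z] --> envelope z.
  rewrite -[X in _ --> X]mul1r -expR0 -(mulr0 s) -(normr0 R) -(subrr z).
  apply: cvgM; last exact: cvg_cst.
  apply: (@continuous_comp _ _ _ (fun y : R => s * `|y - z|) expR);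
    last exact: continuous_expR.
  apply: cvgM; first exact: cvg_cst.
  apply: cvg_norm; apply: cvgB; [exact: cvg_id|exact: cvg_cst].
apply: squeeze_cvgr (cvge (- 16^-1)) (cvge 16^-1).
apply: nearW => y; rewrite envelope_lipschitz andbT.
rewrite mulNr expRN ler_pdivrMl ?expR_gt0// distrC.
exact: envelope_lipschitz.
Qed.

End envelope.

(** * Primitives of continuous functions *)

Section primitive.
Context {R : realType}.
Local Notation mu := (@lebesgue_measure R).

(** The primitive is taken from -1 and normalized at 0, which makes it
    differentiable at 0 as well. *)
Lemma continuous_primitive (h : R -> R) : continuous h ->
  exists F : R -> R, [/\ F 0 = 0, forall x : R, 0 <= x -> is_derive x 1 F (h x) &
    forall x : R, 0 <= x -> (\int[mu]_(t in `[0%R, x]) (h t)%:E)%E = (F x)%:E].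
Proof.
move=> ch.
pose F1 (x : R) := \int[mu]_(t in [set` Interval (BLeft (-1 : R)) (BRight x)]) h t.
have dF1 (x : R) : -1 < x -> is_derive x 1 F1 (h x).
  move=> x1.
  have xx : x < x + 1 by rewrite ltrDl.
  have intf : mu.-integrable [set` Interval (BLeft (-1 : R)) (BRight (x + 1))]
      (EFin \o h).
    apply: continuous_compact_integrable; first exact: segment_compact.
    exact: continuous_subspaceT.
  have [d1 d2] := continuous_FTC1_closed xx intf x1 (ch x).
  by apply: DeriveDef => //; rewrite -derive1E.
pose F := F1 - cst (F1 0).
have dF (x : R) : -1 < x -> is_derive x 1 F (h x).
  by move=> /dF1 ?; apply: is_derive_eq; rewrite subr0.
have cF (x : R) : -1 < x -> {for x, continuous F}.
  move=> x0; apply: differentiable_continuous; apply/derivable1_diffP.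
  by have ? := dF _ x0; exact: ex_derive.
have F0 : F 0 = 0 by rewrite /F !fctE subrr.
exists F; split => //.
  by move=> x x0; apply: dF; rewrite (lt_le_trans _ x0)// ltrN10.
move=> x; rewrite le_eqVlt => /predU1P[<-|x0].
  by rewrite set_itv1 integral_set1 F0.
have gt1 t : 0 <= t -> -1 < t by apply: lt_le_trans; rewrite ltrN10.
rewrite (@continuous_FTC2 _ h F 0 x)//.
- by rewrite F0 sube0.
- exact: continuous_subspaceT.
- split.
  + move=> t; rewrite in_itv/= => /andP[/ltW/gt1/dF ? _]; exact: ex_derive.
  + by apply: cvg_at_right_filter; apply: cF; rewrite ltrN10.
  + by apply: cvg_at_left_filter; apply: cF; apply: gt1; exact: ltW.
- move=> t; rewrite in_itv/= => /andP[/ltW/gt1/dF ? _].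
  by rewrite derive1E derive_val.
Qed.

Lemma cvg_integral_itv0 (h : R -> R) : continuous h -> (forall x, 0 <= h x) ->
  (\int[mu]_(t in `[0%R, n%:R]) (h t)%:E)%E @[n --> \oo] -->
  (\int[mu]_(t in `[0%R, +oo[) (h t)%:E)%E.
Proof.
move=> ch h0.
have -> : `[0%R, +oo[%classic = \bigcup_n `[(0 : R), n%:R]%classic.
  by rewrite itv_bndy_bigcup_BRight; apply: eq_bigcup => // n _; rewrite add0r.
apply: ge0_nondecreasing_set_cvg_integral => //.
- move=> m n mn; apply/subsetPset => x /=; rewrite !in_itv/= => /andP[-> /= xm].
  by rewrite (le_trans xm)// ler_nat.
- move=> n; apply/measurable_EFinP; apply: measurable_funTS.
  exact: continuous_measurable_fun.
- by move=> n x _; rewrite lee_fin.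
Qed.

End primitive.

(** * The transport inequality on the half-line *)

Section one_dim.
Context {R : realType}.
Local Notation mu := (@lebesgue_measure R).

(** The product of the two exponential densities times the exponential of the
    cost: keeping the densities inside the bound lets all integrals be taken
    against plain Lebesgue measure. *)
Definition coupling (x y : R) : R :=
  if (0 < x) && (0 < y) then expR (theta (x - y) - x - y) else 0.

Lemma coupling_ge0 x y : 0 <= coupling x y.
Proof. by rewrite /coupling; case: ifP => // _; exact: expR_ge0. Qed.

Let continuous_weighted (q : R -> R) : continuous q ->
  continuous (fun x => q x * expR (- x)).
Proof.
move=> cq x; apply: cvgM; first exact: cq.
apply: (@continuous_comp _ _ _ -%R expR); last exact: continuous_expR.
exact: opp_continuous.
Qed.

(** The bound on bounded intervals passes to the limit one factor at a time. *)
Lemma weighted_integral_prod_le1 (q p : R -> R) :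
  continuous q -> continuous p -> (forall x, 0 <= q x) -> (forall x, 0 <= p x) ->
  (forall x y, q x * p y <= expR (theta (x - y))) ->
  (\int[mu]_(x in `[0%R, +oo[) (q x * expR (- x))%:E *
   \int[mu]_(x in `[0%R, +oo[) (p x * expR (- x))%:E <= 1)%E.
Proof.
move=> cq cp q0 p0 qp.
pose h1 x := q x * expR (- x); pose h2 x := p x * expR (- x).
have h10 x : 0 <= h1 x by rewrite mulr_ge0 ?expR_ge0.
have h20 x : 0 <= h2 x by rewrite mulr_ge0 ?expR_ge0.
have ch1 : continuous h1 by exact: continuous_weighted.
have ch2 : continuous h2 by exact: continuous_weighted.
have [F [F0 dF FE]] := continuous_primitive _ ch1.
have [G [G0 dG GE]] := continuous_primitive _ ch2.
have G_ge0 x : 0 <= x -> 0 <= G x.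
  by move=> x0; rewrite -lee_fin -GE// integral_ge0// => t _; rewrite lee_fin.
have FG M N : 0 <= M -> 0 <= N -> F M * G N <= 1.
  by move=> *; apply: (primitive_prod_le1 q p F G).
have cF := cvg_integral_itv0 _ ch1 h10.
have cG := cvg_integral_itv0 _ ch2 h20.
rewrite -[X in (X * _ <= _)%E]/(\int[mu]_(x in `[0%R, +oo[) (h1 x)%:E)%E.
rewrite -[X in (_ * X <= _)%E]/(\int[mu]_(x in `[0%R, +oo[) (h2 x)%:E)%E.
set I := (X in (X * _ <= _)%E); set J := (X in (_ * X <= _)%E).
have I0 : (0 <= I)%E by apply: integral_ge0 => x _; rewrite lee_fin.
have J0 : (0 <= J)%E by apply: integral_ge0 => x _; rewrite lee_fin.
have step1 (N : nat) : (I * (G N%:R)%:E <= 1)%E.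
  have : (\int[mu]_(t in `[0%R, n%:R]) (h1 t)%:E * (G N%:R)%:E)%E @[n --> \oo]
    --> (I * (G N%:R)%:E)%E by apply: cvgeZr.
  move=> H; rewrite -(cvg_lim _ H)//; apply: lime_le.
    by apply/cvg_ex; exists (I * (G N%:R)%:E)%E.
  by apply: nearW => n; rewrite FE// -EFinM lee_fin FG.
have [->|I_neq0] := eqVneq I 0%E; first by rewrite mul0e lee_fin.
have I_gt0 : (0 < I)%E by rewrite lt_neqAle eq_sym I_neq0.
(* If the first integral is infinite, step1 forces every G N to vanish. *)
have [Iy|Ify] := eqVneq I +oo%E.
  suff -> : J = 0%E by rewrite mule0 lee_fin.
  apply: (cvg_unique _ cG) => //.
  have -> : (fun n => \int[mu]_(t in `[0%R, n%:R]) (h2 t)%:E)%E = cst 0%E.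
    apply/funext => n; rewrite GE//; congr EFin; apply/eqP.
    rewrite eq_le G_ge0// andbT leNgt; apply/negP => Gn.
    by have := step1 n; rewrite Iy gt0_mulye// leye_eq.
  exact: cvg_cst.
have Ifin : I \is a fin_num by rewrite ge0_fin_numE// ltey.
have H : (I * \int[mu]_(t in `[0%R, n%:R]) (h2 t)%:E)%E @[n --> \oo]
    --> (I * J)%E by apply: cvgeZl.
rewrite -(cvg_lim _ H)//; apply: lime_le.
  by apply/cvg_ex; exists (I * J)%E.
by apply: nearW => n; rewrite GE// step1.
Qed.

(** Maurey's property (tau) of the exponential measure for the cost theta. Unless
    one function vanishes identically, both are finite, supported in the
    positive half-line and dominated, up to the density, by the continuous
    envelopes p and q. *)
Lemma coupling_integral_prod_le1 (f g : R -> \bar R) :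
  measurable_fun setT f -> measurable_fun setT g ->
  (forall x, 0 <= f x)%E -> (forall x, 0 <= g x)%E ->
  (forall x y, f x * g y <= (coupling x y)%:E)%E ->
  (\int[mu]_x f x * \int[mu]_x g x <= 1)%E.
Proof.
move=> mf mg f0 g0 fg.
have [f_eq0|] := pselect (forall x, f x = 0%E).
  by rewrite integral0_eq ?mul0e// lee_fin.
move=> /existsNP[x0 /eqP fx0].
have [g_eq0|] := pselect (forall x, g x = 0%E).
  by rewrite [X in (_ * X)%E]integral0_eq ?mule0// lee_fin.
move=> /existsNP[y0 /eqP gy0].
have {}fx0 : (0 < f x0)%E by rewrite lt_neqAle eq_sym fx0 f0.
have {}gy0 : (0 < g y0)%E by rewrite lt_neqAle eq_sym gy0 g0.
have ffin x : f x \is a fin_num.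
  rewrite ge0_fin_numE// ltey; apply/eqP => fxy.
  by have := fg x y0; rewrite fxy gt0_mulye// leye_eq.
have gfin x : g x \is a fin_num.
  rewrite ge0_fin_numE// ltey; apply/eqP => fxy.
  by have := fg x0 x; rewrite fxy gt0_muley// leye_eq.
have fpos x : (0 < f x)%E -> 0 < x.
  move=> fx; rewrite ltNge; apply/negP => x_le0.
  have := fg x y0; rewrite /coupling ltNge x_le0/= leNgt => /negP; apply.
  exact: mule_gt0.
have gpos x : (0 < g x)%E -> 0 < x.
  move=> gx; rewrite ltNge; apply/negP => x_le0.
  have := fg x0 x; rewrite /coupling [0 < x]ltNge x_le0 andbF leNgt => /negP; apply.
  exact: mule_gt0.
pose D := [set x | (0 < f x)%E].
pose h x := fine (f x) * expR x.
have h_gt0 x : D x -> 0 < h x.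
  by move=> Dx; rewrite mulr_gt0 ?expR_gt0// fine_gt0// Dx ltey_eq ffin.
have D0 : D !=set0 by exists x0.
pose p := envelope D h.
have g_le_p y : 0 < y -> fine (g y) * expR y <= p y.
  move=> y_gt0; apply: le_envelope => // x Dx; rewrite /h.
  have := fg x y; rewrite /coupling (fpos _ Dx) y_gt0/=.
  rewrite -(fineK (ffin x)) -(fineK (gfin y)) -EFinM lee_fin.
  rewrite -addrA -opprD expRD expRN -ler_pdivrMr ?invr_gt0 ?expR_gt0// invrK.
  by apply: le_trans; rewrite expRD le_eqVlt; apply/orP; left; apply/eqP; ring.
have p0 y : 0 < p y.
  apply: (envelope_gt0 _ _ D0 h_gt0 _ y0).
  apply: lt_le_trans (g_le_p _ _); last exact: gpos.
  by rewrite mulr_gt0 ?expR_gt0// fine_gt0// gy0 ltey_eq gfin.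
pose q := envelope setT p.
have T0 : [set: R] !=set0 by exists 0.
have pT x : [set: R] x -> 0 < p x by [].
have f_le_q x : 0 < x -> fine (f x) * expR x <= q x.
  move=> x_gt0; apply: le_envelope => // y _.
  have [fx|] := ltP 0%E (f x).
    by rewrite -thetaN opprB; apply: (envelope_mul _ _ h_gt0).
  move=> fx; have -> : f x = 0%E by apply/le_anti; rewrite fx f0.
  by rewrite !mul0r expR_ge0.
have q0 x : 0 <= q x by exact: envelope_ge0.
have qp x y : q x * p y <= expR (theta (x - y)).
  by rewrite mulrC -thetaN opprB; exact: (envelope_mul _ _ pT).
have cp : continuous p by exact: continuous_envelope.
have cq : continuous q by exact: continuous_envelope.
apply: le_trans (weighted_integral_prod_le1 q p cq cp q0 (fun y => ltW (p0 y)) qp).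
have key (u : R -> \bar R) (v : R -> R) : measurable_fun setT u -> continuous v ->
   (forall x, 0 <= u x)%E -> (forall x, 0 <= v x) ->
   (forall x, u x \is a fin_num) -> (forall x, (0 < u x)%E -> 0 < x) ->
   (forall x, 0 < x -> fine (u x) * expR x <= v x) ->
   (\int[mu]_x u x <= \int[mu]_(x in `[0%R, +oo[) (v x * expR (- x))%:E)%E.
  move=> mu' cv u0 v0 ufin upos uv.
  rewrite [leRHS]integral_mkcond; apply: ge0_le_integral => //.
  - apply/(measurable_restrictT _ _).1 => //; apply/measurable_EFinP.
    apply: measurable_funTS; apply: continuous_measurable_fun.
    exact: continuous_weighted.
  move=> x _; have [ux|ux] := ltP 0%E (u x).
    have x_gt0 := upos _ ux; rewrite patchE mem_set/= ?in_itv/= ?(ltW x_gt0)//.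
    by rewrite -(fineK (ufin x)) lee_fin expRN ler_pdivlMr ?expR_gt0// uv.
  apply: (le_trans ux); rewrite patchE; case: ifP => // _.
  by rewrite lee_fin mulr_ge0 ?expR_ge0.
apply: lee_pmul.
- by apply: integral_ge0.
- by apply: integral_ge0.
- exact: key.
- by apply: key => // x; exact: ltW.
Qed.

End one_dim.

(** * Tensorization *)

Section tensor.
Context {R : realType}.
Local Notation mu := (@lebesgue_measure R).
Local Notation RT := (measurableTypeR R).

Lemma measurable_fun_tcons_pair n (f : n.+1.-tuple RT -> \bar R) :
  measurable_fun setT f ->
  measurable_fun setT (fun z : RT * n.-tuple RT => f (tcons z)).
Proof. by move=> mf; apply: measurableT_comp => //; exact: measurable_tcons. Qed.

Lemma integral_tcons n (f : n.+1.-tuple RT -> \bar R) :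
  measurable_fun setT f -> (forall u, 0 <= f u)%E ->
  (\int[@lebesgue_tuple R n.+1]_u f u =
   \int[mu]_x \int[@lebesgue_tuple R n]_t f (tcons (x, t)))%E.
Proof.
move=> mf f0.
rewrite -(@fubini_tonelli1 _ _ _ _ _ mu (@lebesgue_tuple R n) (fun z => f (tcons z)))//;
  last exact: measurable_fun_tcons_pair.
rewrite [LHS](_ : _ = \int[pushforward (mu \x @lebesgue_tuple R n)%E tcons]_u f u)%E//.
by rewrite ge0_integral_pushforward//; exact: measurable_tcons.
Qed.

Lemma measurable_integral_tcons n (f : n.+1.-tuple RT -> \bar R) :
  measurable_fun setT f -> (forall u, 0 <= f u)%E ->
  measurable_fun setT (fun x => \int[@lebesgue_tuple R n]_t f (tcons (x, t)))%E.
Proof.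
move=> mf f0.
apply: (@measurable_fun_fubini_tonelli_F _ _ _ _ _ (@lebesgue_tuple R n)
  (fun z => f (tcons z))) => //; exact: measurable_fun_tcons_pair.
Qed.

Lemma measurable_fun_tcons n (f : n.+1.-tuple RT -> \bar R) x :
  measurable_fun setT f -> measurable_fun setT (fun t => f (tcons (x, t))).
Proof.
move=> mf; have mf' := measurable_fun_tcons_pair _ _ mf.
exact: measurableT_comp mf' _.
Qed.

(** Since coupling is a product over the coordinates, freezing the first
    coordinates x and y leaves an instance of the same statement in one
    dimension less, up to the factor coupling x y. Its conclusion bounds the
    product of the partial integrals by coupling x y, which is the hypothesis
    of the one-dimensional case. *)
Lemma tuple_coupling_integral_prod_le1 n (f g : n.-tuple RT -> \bar R) :
  measurable_fun setT f -> measurable_fun setT g ->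
  (forall u, 0 <= f u)%E -> (forall u, 0 <= g u)%E ->
  (forall u v, f u * g v <= (\prod_(i < n) coupling (tnth u i) (tnth v i))%:E)%E ->
  (\int[@lebesgue_tuple R n]_u f u * \int[@lebesgue_tuple R n]_u g u <= 1)%E.
Proof.
elim: n f g => [|n IHn] f g mf mg f0 g0 fg.
  rewrite /= !integral_dirac// !diracT !mul1e.
  by have := fg [tuple] [tuple]; rewrite big_ord0.
rewrite !integral_tcons//.
have I0 (h : n.+1.-tuple RT -> \bar R) x : (forall u, 0 <= h u)%E ->
    (0 <= \int[@lebesgue_tuple R n]_t h (tcons (x, t)))%E.
  by move=> h0; exact: integral_ge0.
apply: coupling_integral_prod_le1.
- exact: measurable_integral_tcons.
- exact: measurable_integral_tcons.
- by move=> x; exact: I0.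
- by move=> x; exact: I0.
move=> x y.
have fg' t s : (f (tcons (x, t)) * g (tcons (y, s)) <=
    (coupling x y * \prod_(i < n) coupling (tnth t i) (tnth s i))%:E)%E.
  have := fg (tcons (x, t)) (tcons (y, s)).
  rewrite big_ord_recl !tnth0; congr (_ <= (_ * _)%:E)%E.
  by apply: eq_bigr => i _; rewrite !tnthS.
(* If the coupling vanishes, one of the two frozen functions is zero. *)
have := coupling_ge0 x y; rewrite le_eqVlt => /predU1P[c0|c0].
  rewrite -c0.
  have [fx0|] := pselect (forall t, f (tcons (x, t)) = 0%E).
    by rewrite integral0_eq// mul0e.
  move=> /existsNP[t /eqP ft].
  have {}ft : (0 < f (tcons (x, t)))%E by rewrite lt_neqAle eq_sym ft f0.
  rewrite [X in (_ * X)%E]integral0_eq ?mule0// => s _.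
  apply/le_anti; rewrite g0 andbT leNgt; apply/negP => gs.
  have := fg' t s; rewrite -c0 mul0r leNgt => /negP; apply; exact: mule_gt0.
have IH : (\int[@lebesgue_tuple R n]_t ((coupling x y)^-1%:E * f (tcons (x, t))) *
    \int[@lebesgue_tuple R n]_t g (tcons (y, t)) <= 1)%E.
  apply: IHn.
  - by apply: measurable_funeM; exact: measurable_fun_tcons.
  - exact: measurable_fun_tcons.
  - by move=> u; rewrite mule_ge0// lee_fin invr_ge0 ltW.
  - by move=> u.
  - move=> t s; rewrite -muleA.
    have := fg' t s; rewrite EFinM -lee_pdivrMl//.
move: IH; rewrite ge0_integralZl//; last 2 first.
- exact: measurable_fun_tcons.
- by rewrite lee_fin invr_ge0 ltW.
by rewrite -muleA lee_pdivrMl// mule1.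
Qed.

End tensor.

(** * Scaling and cones over sets of directions *)

Section cone.
Context {R : realType}.
Local Notation mu := (@lebesgue_measure R).
Local Notation RT := (measurableTypeR R).

Lemma lebesgue_measure_affine (c b : R) (A : set RT) : 0 < c -> measurable A ->
  (mu A = c%:E * mu ((fun x => c * x + b)%R @^-1` A))%E.
Proof.
move=> c0 mA.
have mphi : measurable_fun setT ((fun x => c * x + b)%R : RT -> RT).
  by apply: measurable_funD => //; apply: measurable_funM.
pose phi : RT -> RT := fun x => (c * x + b)%R.
pose nu := mscale (NngNum (ltW c0)) (pushforward mu phi).
rewrite -[RHS]/(nu mphi A).
have H := @lebesgue_measure_unique R (nu mphi); apply: H => // _ [[x y] _ <-].
rewrite -[RHS]/(c%:E * mu (phi @^-1` `]x, y]%classic))%E.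
have -> : phi @^-1` `]x, y]%classic = `](x - b) / c, (y - b) / c]%classic.
  apply/seteqP; split => z /=; rewrite !in_itv/= ltr_pdivrMr// ler_pdivlMr//;
    by rewrite ltrBlDr lerBrDr (mulrC z).
rewrite !lebesgue_measure_itv/= !lte_fin ltr_pM2r ?invr_gt0// ltrD2r.
case: ifPn => _; last by rewrite mule0.
rewrite -!EFinB -EFinM; congr EFin; field.
by rewrite gt_eqF.
Qed.

Lemma integral_affine (c b : R) (f : RT -> \bar R) : 0 < c ->
  measurable_fun setT f -> (forall x, 0 <= f x)%E ->
  (\int[mu]_x f x = c%:E * \int[mu]_x f (c * x + b)%R)%E.
Proof.
move=> c0 mf f0.
have mphi : measurable_fun setT ((fun x => c * x + b)%R : RT -> RT).
  by apply: measurable_funD => //; apply: measurable_funM.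
pose phi : RT -> RT := fun x => (c * x + b)%R.
pose nu := mscale (NngNum (ltW c0)) (pushforward mu phi).
rewrite (eq_measure_integral (nu mphi)); last first.
  by move=> A mA _; exact: lebesgue_measure_affine.
by rewrite ge0_integral_mscale// ge0_integral_pushforward.
Qed.

Definition tscale n (c : R) (t : n.-tuple RT) : n.-tuple RT :=
  [tuple of map (fun x : RT => c * x : RT) t].

Lemma tnth_tscale n c (t : n.-tuple RT) i : tnth (tscale n c t) i = c * tnth t i.
Proof. by rewrite tnth_map. Qed.

Lemma measurable_tscale_pair n d (T : measurableType d) (c : T -> R)
    (t : T -> n.-tuple RT) :
  measurable_fun setT c -> measurable_fun setT t ->
  measurable_fun setT (fun x => tscale n (c x) (t x)).
Proof.
move=> mc mt; apply/measurable_fun_tnthP => i.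
rewrite (_ : _ \o _ = (fun x => c x * tnth (t x) i)); last first.
  by apply/funext => x /=; rewrite tnth_tscale.
by apply: measurable_funM => //; exact: measurableT_comp (measurable_tnth i) mt.
Qed.

Lemma measurable_tscale n (c : R) : measurable_fun setT (tscale n c).
Proof.
by apply: (measurable_tscale_pair n _ _ (cst c) id).
Qed.

Lemma integral_tscale n (c : R) (f : n.-tuple RT -> \bar R) : 0 < c ->
  measurable_fun setT f -> (forall u, 0 <= f u)%E ->
  (\int[@lebesgue_tuple R n]_u f u =
   (c ^+ n)%:E * \int[@lebesgue_tuple R n]_u f (tscale n c u))%E.
Proof.
move=> c0; elim: n f => [|n IHn] f mf f0.
  rewrite expr0 mul1e; apply: eq_integral => u _; congr f.
  by apply: eq_from_tnth => -[].
have mfc : measurable_fun setT (f \o tscale n.+1 c).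
  by apply: measurableT_comp => //; exact: measurable_tscale.
rewrite !integral_tcons//.
have mI := measurable_integral_tcons _ _ mf f0.
rewrite (integral_affine c 0)//; last by move=> x; exact: integral_ge0.
under eq_integral => x _.
  rewrite addr0 IHn//; last exact: measurable_fun_tcons.
  over.
rewrite ge0_integralZl//; first last.
- by rewrite lee_fin exprn_ge0// ltW.
- by move=> x _; exact: integral_ge0.
- rewrite (_ : (fun x => _) = (fun x =>
      \int[lebesgue_tuple n]_t (f \o tscale n.+1 c) (tcons (x, t)))%E).
    by apply: measurable_integral_tcons => // u; exact: f0.
  apply/funext => x; apply: eq_integral => t _; congr f; exact: val_inj.
rewrite muleA -EFinM -exprS; congr (_ * _)%E.
apply: eq_integral => x _; apply: eq_integral => t _; congr f; exact: val_inj.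
Qed.

Definition tsum n (u : n.-tuple RT) : R := \sum_(i < n) tnth u i.

Lemma measurable_tsum n : measurable_fun setT (tsum n).
Proof.
by apply: measurable_sum => i; exact: measurable_tnth.
Qed.

Lemma tsum_tcons n x (t : n.-tuple RT) : tsum n.+1 (tcons (x, t)) = x + tsum n t.
Proof.
rewrite /tsum big_ord_recl tnth0; congr (_ + _).
by apply: eq_bigr => i _; rewrite tnthS.
Qed.

(** Vectors of coordinate sum s >= a whose direction, rescaled to have sum w,
    lies in A. The first coordinate is determined by s and the others, so A
    records only the last k coordinates. *)
Definition tcone k (a w : R) (A : set (k.-tuple RT)) : set (k.+1.-tuple RT) :=
  [set u | a <= tsum k.+1 u /\ A (tscale k (w / tsum k.+1 u) [tuple of behead u])].

(** The power -1 agrees with the inverse where s >= a > 0 and is a measurable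
    function on the whole line. *)
Lemma indic_tconeE k a w A u : 0 < a ->
  \1_(tcone k a w A) u = \1_(`[a, +oo[%classic) (tsum k.+1 u) *
    \1_A (tscale k (w * powR (tsum k.+1 u) (-1)) [tuple of behead u]) :> R.
Proof.
move=> a0; rewrite !indicE.
have -> : (tsum k.+1 u \in `[a, +oo[%classic) = (a <= tsum k.+1 u).
  by apply/idP/idP; rewrite inE/= in_itv/= andbT.
have [au|ua] := leP a (tsum k.+1 u); rewrite ?mul1r ?mul0r.
  rewrite powR_inv1 ?(le_trans (ltW a0))//.
  congr (nat_of_bool _)%:R; apply/idP/idP; rewrite !inE; first by case.
  by split.
rewrite (_ : (_ \in _) = false)//; apply/negP; rewrite inE => -[].
by rewrite leNgt ua.
Qed.

Lemma measurable_tcone k a w A : 0 < a -> measurable A ->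
  measurable (tcone k a w A).
Proof.
move=> a0 mA; apply/(@measurable_indicP _ _ R).
rewrite (funext (fun u => indic_tconeE k a w A u a0)).
apply: measurable_funM.
  by apply: measurableT_comp; [exact: measurable_indic|exact: measurable_tsum].
apply: measurableT_comp; first exact: measurable_indic.
apply: measurable_tscale_pair; last exact: measurable_behead.
apply: measurable_funM => //.
exact: (measurableT_comp (measurable_powR _) (measurable_tsum _)).
Qed.

(** Polar coordinates adapted to the coordinate sum: substitute the sum s for
    the first coordinate (a translation once the others are frozen), exchange
    the integrals, then rescale the other k coordinates by s / w. *)
Lemma tcone_integral k (a w : R) (A : set (k.-tuple RT)) : 0 < a -> 0 < w ->
  measurable A ->
  (\int[@lebesgue_tuple R k.+1]_u
     (\1_(tcone k a w A) u * expR (- tsum k.+1 u))%:E =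
   \int[mu]_(s in `[a, +oo[) ((s / w) ^+ k * expR (- s))%:E *
     @lebesgue_tuple R k A)%E.
Proof.
move=> a0 w0 mA.
pose H (z : RT * k.-tuple RT) : \bar R := (\1_(`[a, +oo[%classic) z.1 * expR (- z.1) *
  \1_A (tscale k (w * powR z.1 (-1)) z.2))%:E.
have H0 z : (0 <= H z)%E by rewrite lee_fin !mulr_ge0 ?expR_ge0.
have mexp : measurable_fun setT (fun x : R => expR (- x)).
  by apply: measurableT_comp => //; exact: measurable_expR.
have mH : measurable_fun setT H.
  apply/measurable_EFinP; apply: measurable_funM.
    apply: measurable_funM.
      by apply: measurableT_comp; [exact: measurable_indic|].
    exact: (measurableT_comp mexp).
  apply: measurableT_comp; first exact: measurable_indic.
  apply: measurable_tscale_pair => //.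
  apply: measurable_funM => //.
  exact: (measurableT_comp (measurable_powR _)).
pose F (u : k.+1.-tuple RT) := H (tsum k.+1 u, [tuple of behead u]).
have -> : (fun u => (\1_(tcone k a w A) u * expR (- tsum k.+1 u))%:E) = F.
  apply/funext => u; rewrite /F /H indic_tconeE//=; congr EFin; ring.
have mF : measurable_fun setT F.
  apply: (measurableT_comp mH); apply/measurable_fun_pairP; split.
    exact: measurable_tsum.
  exact: measurable_behead.
rewrite integral_tcons//.
have mG : measurable_fun setT (fun z : RT * k.-tuple RT => F (tcons z)).
  exact: measurable_fun_tcons_pair.
rewrite (@fubini_tonelli _ _ _ _ _ mu (@lebesgue_tuple R k)
  (fun z => F (tcons z)))//; last by move=> z; exact: H0.
have HE x t : F (tcons (x, t)) = H (1 * x + tsum k t, t).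
  rewrite /F tsum_tcons mul1r; congr (H (_, _)); exact: val_inj.
have shift t : (\int[mu]_x F (tcons (x, t)) = \int[mu]_x H (x, t))%E.
  rewrite (integral_affine 1 (tsum k t) (fun s => H (s, t)))//; last first.
    exact: measurableT_comp mH _.
  by rewrite mul1e; apply: eq_integral => x _; rewrite HE.
rewrite (eq_integral _ _ (fun t _ => shift t)).
rewrite -(@fubini_tonelli _ _ _ _ _ mu (@lebesgue_tuple R k) H)//.
rewrite [in RHS]integral_mkcond/=.
rewrite -ge0_integralZr//; first last.
- move=> s _; rewrite patchE; case: ifPn => // /[!inE]/=.
  rewrite in_itv/= andbT => as_; rewrite lee_fin mulr_ge0 ?expR_ge0//.
  by rewrite exprn_ge0// divr_ge0 ?(ltW w0)// (le_trans (ltW a0)).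
- apply/(measurable_restrictT _ _).1 => //; apply/measurable_EFinP.
  apply: measurable_funTS; apply: measurable_funM => //.
  by apply: measurable_funX; apply: measurable_funM.
apply: eq_integral => s _; rewrite patchE.
have mA' (c : R) : measurable_fun setT (fun u : k.-tuple RT => (\1_A u)%:E : \bar R).
  by apply/measurable_EFinP; exact: measurable_indic.
have sE : (s \in `[a, +oo[%classic) = (a <= s).
  by apply/idP/idP; rewrite inE/= in_itv/= andbT.
rewrite /H/= indicE sE; case: ifPn => [as_|_]; last first.
  rewrite integral0_eq; first exact/esym/mul0e.
  by move=> t _; rewrite !mul0r.
have s0 : 0 < s by exact: lt_le_trans as_.
under eq_integral do rewrite mul1r EFinM.
rewrite powR_inv1 ?(ltW s0)//.
have c0 : 0 < w / s by rewrite divr_gt0.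
have mB : measurable_fun setT
    (fun u : k.-tuple RT => (\1_A (tscale k (w / s) u))%:E : \bar R).
  exact: (measurableT_comp (mA' 0) (measurable_tscale _ _)).
rewrite ge0_integralZl//.
have -> : (@lebesgue_tuple R k A =
    ((w / s) ^+ k)%:E * \int[@lebesgue_tuple R k]_u (\1_A (tscale k (w / s) u))%:E)%E.
  rewrite -(integral_tscale k (w / s) (fun u => (\1_A u)%:E))//.
    by rewrite integral_indic// setIT.
  exact: (mA' 0).
rewrite muleA -EFinM mulrAC -exprMn -(invf_div w s) mulVf ?gt_eqF//.
by rewrite expr1n mul1r.
Qed.

End cone.

(** * Tails of the Gamma integral *)

Section gamma.
Context {R : realType}.
Local Notation mu := (@lebesgue_measure R).

Definition expsum k (a : R) : R := \sum_(j < k.+1) a ^+ j / j`!%:R.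

Lemma expsum_ge0 k (a : R) : 0 <= a -> 0 <= expsum k a.
Proof. by move=> a0; apply: sumr_ge0 => j _; rewrite divr_ge0// exprn_ge0. Qed.

Lemma expsum0 k : expsum k 0 = 1.
Proof.
rewrite /expsum big_ord_recl expr0 divr1 big1 ?addr0// => i _.
by rewrite lift0 expr0n/= mul0r.
Qed.

Lemma expsumS k : expsum k.+1 =
  (expsum k + (fun a => (k.+1)`!%:R^-1 * a ^+ k.+1))%R :> (R -> R).
Proof. by apply/funext => a; rewrite /expsum big_ord_recr/= fctE mulrC. Qed.

Lemma is_derive_expsum k (a : R) :
  is_derive a 1 (expsum k) (if k is k'.+1 then expsum k' a else 0).
Proof.
elim: k => [|k IHk].
  rewrite (_ : expsum 0 = cst 1); first exact: is_derive_cst.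
  by apply/funext => x; rewrite /expsum big_ord1 expr0 divr1.
have H : is_derive a 1 (fun a : R => (k.+1)`!%:R^-1 * a ^+ k.+1) (k`!%:R^-1 * a ^+ k).
  have -> : (fun a : R => (k.+1)`!%:R^-1 * a ^+ k.+1) =
      ((k.+1)`!%:R^-1 : R) \*: (@id R ^+ k.+1).
    by apply/funext => x; rewrite /= exprfctE.
  apply: is_derive_eq; rewrite /GRing.scale/= mulr1 factS natrM.
  by rewrite invfM mulrACA mulVf ?mul1r// pnatr_eq0.
rewrite expsumS; apply: is_derive_eq.
case: k {IHk H} => [|k]; last by rewrite expsumS fctE.
by rewrite add0r expr0 mulr1 /expsum big_ord1 expr0 div1r.
Qed.

(** Markov's inequality for a Poisson variable of mean a, proved by induction:
    the derivative of the left-hand side at k.+1 is (k + 1) / (k + 2) times the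
    left-hand side at k. *)
Lemma expR_le_expsum k (a : R) : 0 <= a ->
  expR a * (1 - a / k.+1%:R) <= expsum k a.
Proof.
elim: k a => [|k IHk] a a0.
  rewrite /expsum big_ord1 expr0 !divr1 mulrC -ler_pdivlMr ?expR_gt0// div1r -expRN.
  exact: expR_ge1Dx.
move: a0; rewrite le_eqVlt => /predU1P[<-|a0].
  by rewrite mul0r subr0 expR0 mulr1 expsum0.
pose D (s : R) := expR s * (1 - s / k.+2%:R).
have dD (s : R) : is_derive s 1 (expsum k.+1 - D)
    (expsum k s - k.+1%:R / k.+2%:R * (expR s * (1 - s / k.+1%:R))).
  have H1 := is_derive_expsum k.+1 s.
  have H2 : is_derive s 1 D (k.+1%:R / k.+2%:R * (expR s * (1 - s / k.+1%:R))).
    apply: is_derive_eq; rewrite /GRing.scale/=.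
    rewrite -[k.+2%:R]natr1; have : 0 < k.+1%:R :> R by [].
    move: (k.+1%:R : R) => r r0.
    by field; rewrite (gt_eqF r0) gt_eqF ?addr_gt0//.
  exact: (is_deriveB H1 H2).
have [c] := @MVT R (expsum k.+1 - D) _ 0 a a0 (fun z _ => dD z)
  (continuous_subspaceT (fun z => differentiable_continuous
    (proj1 (derivable1_diffP _ _) (@ex_derive _ _ _ _ _ _ _ (dD z))))).
rewrite in_itv/= => /andP[c0 _].
rewrite !fctE /D expsum0 expR0 mul0r subr0 mulr1 subrr subr0 => E.
rewrite -subr_ge0 E subr0 mulr_ge0 ?(ltW a0)// subr_ge0.
have := IHk c (ltW c0); have := expsum_ge0 k c (ltW c0).
set X := expR c * _; set Y := expsum k c => Y0 XY.
have r0 : 0 <= k.+1%:R / k.+2%:R :> R by rewrite divr_ge0.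
have r1 : k.+1%:R / k.+2%:R <= 1 :> R by rewrite ler_pdivrMr// mul1r ler_nat.
apply: (le_trans (ler_wpM2l r0 XY)); exact: ler_piMl.
Qed.

Let cvg_pow_expRN k : x ^+ k * expR (- x) @[x --> +oo%R] --> (0 : R).
Proof.
have H : (k.+1)`!%:R / x @[x --> +oo%R] --> (0 : R).
  rewrite -[X in _ --> X](mulr0 (k.+1)`!%:R); apply: cvgM; first exact: cvg_cst.
  by apply/gtr0_cvgV0; [exact: nbhs_pinfty_gt|exact: cvg_id].
apply: (@squeeze_cvgr _ _ _ _ (cst 0)) H; last exact: cvg_cst.
near=> x.
have x0 : 0 < x by near: x; exact: nbhs_pinfty_gt.
rewrite mulr_ge0 ?exprn_ge0 ?expR_ge0 ?(ltW x0)//= expRN ler_pdivrMr ?expR_gt0//.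
rewrite mulrAC ler_pdivlMr// -exprSr mulrC -ler_pdivrMr ?ltr0n ?fact_gt0//.
apply: le_trans (expR_ge1Dxn k (ltW x0)).
by rewrite lerDr.
Unshelve. all: by end_near. Qed.

Lemma gamma_tail k (a : R) : 0 <= a ->
  (\int[mu]_(s in `[a, +oo[) (s ^+ k * expR (- s))%:E =
   (k`!%:R * (expR (- a) * expsum k a))%:E)%E.
Proof.
move=> a0.
pose F (s : R) := - k`!%:R * (expR (- s) * expsum k s).
have dexp (s : R) : is_derive s 1 (fun s : R => expR (- s)) (- expR (- s)).
  have -> : - expR (- s) = expR (- s) * (-1) by rewrite mulrN1.
  exact: (@is_derive1_comp R expR -%R).
have dF (s : R) : is_derive s 1 F (s ^+ k * expR (- s)).
  have H := is_derive_expsum k s; apply: is_derive_eq.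
  rewrite /GRing.scale/=; case: k {F H} => [|k].
    by rewrite /expsum big_ord1 expr0 fact0; field.
  rewrite expsumS fctE; field.
  by rewrite pnatr_eq0 -lt0n fact_gt0.
have cF : continuous F.
  move=> s; apply: differentiable_continuous; apply/derivable1_diffP.
  by have ? := dF s; exact: ex_derive.
rewrite (@ge0_continuous_FTC2y R _ F a 0).
- by rewrite sub0e /F -EFinN mulNr opprK.
- by move=> x ax; rewrite mulr_ge0 ?expR_ge0// exprn_ge0// (le_trans a0).
- apply: continuous_subspaceT => s; apply: cvgM.
    exact: exprn_continuous.
  apply: (@continuous_comp _ _ _ -%R expR); last exact: continuous_expR.
  exact: opp_continuous.
- have -> : F = (fun s => \sum_(j < k.+1) (- k`!%:R / j`!%:R) * (s ^+ j * expR (- s))).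
    apply/funext => s; rewrite /F /expsum 2!mulr_sumr; apply: eq_bigr => j _.
    by ring.
  rewrite [X in _ --> X](_ : 0 = \sum_(j < k.+1) (- k`!%:R / j`!%:R * 0 : R)); last first.
    by rewrite big1// => j _; rewrite mulr0.
  apply: cvg_big => [|j _]; first exact: add_continuous.
  by apply: cvgM; [exact: cvg_cst|exact: cvg_pow_expRN].
- by move=> x _; have H := dF x; exact: (@ex_derive _ _ _ _ _ _ _ H).
- by apply: cvg_at_right_filter; exact: cF.
- by move=> x _; rewrite derive1E; have ? := dF x; exact: derive_val.
Qed.

Lemma gamma_tail_ge k (a : R) : 0 <= a ->
  ((k`!%:R * (1 - a / k.+1%:R))%:E <=
    \int[mu]_(s in `[a, +oo[) (s ^+ k * expR (- s))%:E)%E.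
Proof.
move=> a0; rewrite gamma_tail// lee_fin ler_wpM2l// expRN ler_pdivlMl ?expR_gt0//.
exact: expR_le_expsum.
Qed.

End gamma.

(** * The product exponential measure *)

Section exponential.
Context {R : realType}.
Local Notation mu := (@lebesgue_measure R).
Local Notation RT := (measurableTypeR R).

Definition expd (x : R) : R := if 0 < x then expR (- x) else 0.

Lemma expd_ge0 x : 0 <= expd x.
Proof. by rewrite /expd; case: ifP => // _; exact: expR_ge0. Qed.

Lemma measurable_expd : measurable_fun setT expd.
Proof.
apply: measurable_fun_ifT => //.
  by apply: measurable_fun_ltr.
by apply: measurableT_comp => //; exact: measurable_expR.
Qed.

Lemma expd_moment k :
  (\int[mu]_x (x ^+ k * expd x)%:E = (k`!%:R)%:E :> \bar R)%E.
Proof.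
have cf : continuous (fun x : R => x ^+ k * expR (- x)).
  move=> s; apply: cvgM; first exact: exprn_continuous.
  apply: (@continuous_comp _ _ _ -%R expR); last exact: continuous_expR.
  exact: opp_continuous.
transitivity (\int[mu]_(x in `]0%R, +oo[) (x ^+ k * expR (- x))%:E)%E.
  rewrite [RHS]integral_mkcond; apply: eq_integral => x _.
  rewrite patchE /expd.
  have -> : (x \in `]0, +oo[%classic) = (0 < x).
    by apply/idP/idP; rewrite inE/= in_itv/= andbT.
  by case: ifP => // _; rewrite mulr0.
rewrite integral_itv_obnd_cbnd; last first.
  by apply/measurable_EFinP; apply: measurable_funTS; exact: continuous_measurable_fun.
by rewrite gamma_tail// oppr0 expR0 expsum0 !mulr1.
Qed.

Definition texpd n (u : n.-tuple RT) : R := \prod_(i < n) expd (tnth u i).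

Lemma texpd_ge0 n u : 0 <= texpd n u.
Proof. by apply: prodr_ge0 => i _; exact: expd_ge0. Qed.

Lemma measurable_texpd n : measurable_fun setT (texpd n).
Proof.
apply: measurable_prod => i _.
exact: (measurableT_comp measurable_expd (measurable_tnth i)).
Qed.

Lemma texpd_tcons n x (t : n.-tuple RT) :
  texpd n.+1 (tcons (x, t)) = expd x * texpd n t.
Proof.
rewrite /texpd big_ord_recl tnth0; congr (_ * _).
by apply: eq_bigr => i _; rewrite tnthS.
Qed.

Lemma texpd_gt0E n (u : n.-tuple RT) : (forall i, 0 < tnth u i) ->
  texpd n u = expR (- tsum n u).
Proof.
move=> u0; rewrite /tsum -sumrN expR_sum; apply: eq_bigr => i _.
by rewrite /expd u0.
Qed.

Let tint_ge0 n : forall u : n.-tuple RT, (0 <= (texpd n u)%:E)%E.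
Proof. by move=> u; rewrite lee_fin texpd_ge0. Qed.

Let mE n : measurable_fun setT (fun u : n.-tuple RT => (texpd n u)%:E).
Proof. by apply/measurable_EFinP; exact: measurable_texpd. Qed.

Lemma texpd_integral n : (\int[@lebesgue_tuple R n]_u (texpd n u)%:E = 1)%E.
Proof.
elim: n => [|n IHn].
  rewrite /= integral_dirac//; last exact: mE.
  by rewrite diracT mul1e /texpd big_ord0.
rewrite integral_tcons//.
transitivity (\int[mu]_x (x ^+ 0 * expd x)%:E)%E; last by rewrite expd_moment.
apply: eq_integral => x _; rewrite expr0 mul1r.
under eq_integral do rewrite texpd_tcons EFinM.
rewrite ge0_integralZl//; first by rewrite IHn mule1.
  exact: mE.
by rewrite lee_fin expd_ge0.
Qed.

Definition tsqr n (u : n.-tuple RT) : R := \sum_(i < n) tnth u i ^+ 2.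

Lemma tsqr_ge0 n u : 0 <= tsqr n u.
Proof. by apply: sumr_ge0 => i _; exact: sqr_ge0. Qed.

Lemma measurable_tsqr n : measurable_fun setT (tsqr n).
Proof.
apply: measurable_sum => i; apply: measurable_funX; exact: measurable_tnth.
Qed.

Lemma measurable_tsqr_le n (c : R) : measurable [set u | tsqr n u <= c].
Proof.
rewrite (_ : [set u | _] = tsqr n @^-1` `]-oo, c]%classic).
  by rewrite -[X in measurable X]setTI; exact: measurable_tsqr.
by apply/seteqP; split => u /=; rewrite in_itv.
Qed.

Lemma tsqr_tcons n x (t : n.-tuple RT) :
  tsqr n.+1 (tcons (x, t)) = x ^+ 2 + tsqr n t.
Proof.
rewrite /tsqr big_ord_recl tnth0; congr (_ + _).
by apply: eq_bigr => i _; rewrite tnthS.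
Qed.

(** The second moment of an exponential variable is 2. *)
Lemma tsqr_expectation n :
  (\int[@lebesgue_tuple R n]_u (tsqr n u * texpd n u)%:E = (2 * n%:R)%:E)%E.
Proof.
have mS m : measurable_fun setT (fun u : m.-tuple RT => (tsqr m u * texpd m u)%:E).
  apply/measurable_EFinP; apply: measurable_funM; first exact: measurable_tsqr.
  exact: measurable_texpd.
have S0 m (u : m.-tuple RT) : (0 <= (tsqr m u * texpd m u)%:E)%E.
  by rewrite lee_fin mulr_ge0 ?tsqr_ge0 ?texpd_ge0.
elim: n => [|n IHn].
  rewrite /= integral_dirac//; last exact: mS.
  by rewrite diracT mul1e /tsqr big_ord0 mul0r mulr0.
rewrite integral_tcons//.
transitivity (\int[mu]_x
    ((x ^+ 2 * expd x)%:E + (2 * n%:R)%:E * (x ^+ 0 * expd x)%:E))%E.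
  apply: eq_integral => x _.
  transitivity (\int[@lebesgue_tuple R n]_t ((x ^+ 2 * expd x)%:E * (texpd n t)%:E +
      (expd x)%:E * (tsqr n t * texpd n t)%:E))%E.
    apply: eq_integral => t _; rewrite tsqr_tcons texpd_tcons -!EFinM -EFinD.
    by congr EFin; ring.
  rewrite ge0_integralD//.
  - rewrite ge0_integralZl//; last 2 first.
    + exact: mE.
    + by rewrite lee_fin mulr_ge0 ?sqr_ge0 ?expd_ge0.
    rewrite ge0_integralZl//; last 2 first.
    + exact: mS.
    + by rewrite lee_fin expd_ge0.
    rewrite texpd_integral IHn mule1 expr0 mul1r; congr (_ + _)%E.
    by rewrite muleC.
  - by move=> t _; rewrite mule_ge0// lee_fin mulr_ge0 ?sqr_ge0 ?expd_ge0.
  - by apply: measurable_funeM; exact: mE.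
  - by move=> t _; rewrite mule_ge0// lee_fin ?expd_ge0.
  - by apply: measurable_funeM; exact: mS.
have mk k : measurable_fun setT (fun x : R => (x ^+ k * expd x)%:E).
  apply/measurable_EFinP; apply: measurable_funM; first exact: measurable_funX.
  exact: measurable_expd.
rewrite ge0_integralD//.
- rewrite ge0_integralZl//.
  + rewrite !expd_moment -EFinM -EFinD; congr EFin.
    by rewrite fact0 mulr1 -[n.+1%:R]natr1 mulrDr mulr1 addrC.
  + exact: mk.
  + by move=> x _; rewrite lee_fin mulr_ge0 ?expd_ge0.
- by move=> x _; rewrite lee_fin mulr_ge0 ?sqr_ge0 ?expd_ge0.
- exact: mk.
- by move=> x _; rewrite mule_ge0// lee_fin mulr_ge0 ?expd_ge0.
- by apply: measurable_funeM; exact: mk.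
Qed.

Definition expprob n (X : set (n.-tuple RT)) : \bar R :=
  (\int[@lebesgue_tuple R n]_u (\1_X u * texpd n u)%:E)%E.

Lemma expprob_ge0 n X : (0 <= expprob n X)%E.
Proof.
by apply: integral_ge0 => u _; rewrite lee_fin mulr_ge0 ?texpd_ge0.
Qed.

Let mindic n (X : set (n.-tuple RT)) : measurable X ->
  measurable_fun setT (fun u => (\1_X u * texpd n u)%:E : \bar R).
Proof.
move=> mX; apply/measurable_EFinP; apply: measurable_funM.
  exact: measurable_indic.
exact: measurable_texpd.
Qed.

Lemma expprob_split n (X Y : set (n.-tuple RT)) : measurable X -> measurable Y ->
  expprob n X = (expprob n (X `&` Y) + expprob n (X `\` Y))%E.
Proof.
move=> mX mY; have mI := measurableI _ _ mX mY; have mD := measurableD mX mY.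
rewrite /expprob -ge0_integralD//; first last.
- exact: mindic.
- by move=> u _; rewrite lee_fin mulr_ge0 ?texpd_ge0.
- exact: mindic.
- by move=> u _; rewrite lee_fin mulr_ge0 ?texpd_ge0.
apply: eq_integral => u _; rewrite -EFinD -mulrDl; congr (_ * _)%:E.
rewrite setDE !indicI indicC/= -mulrDr.
by rewrite !indicE; case: (u \in Y); rewrite /= ?addr0 ?add0r mulr1.
Qed.

Lemma expprob_le1 n X : measurable X -> (expprob n X <= 1)%E.
Proof.
move=> mX; rewrite -(texpd_integral n); apply: ge0_le_integral => //.
- by move=> u _; rewrite lee_fin mulr_ge0 ?texpd_ge0.
- exact: mindic.
- exact: mE.
- by move=> u _; rewrite lee_fin ler_piMl ?texpd_ge0// indicE; case: (_ \in _).
Qed.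

(** Markov's inequality with the second moment 2 * n. *)
Lemma expprob_tsqr n : (0 < n)%N ->
  ((1 / 2)%:E <= expprob n [set u | (tsqr n u <= 4 * n%:R)%R])%E.
Proof.
move=> n0; set M := [set u | _].
have mM : measurable M by exact: measurable_tsqr_le.
have E : expprob n setT = 1%E.
  by rewrite -(texpd_integral n); apply: eq_integral => u _; rewrite indicT mul1r.
have := expprob_split n setT M measurableT mM; rewrite E setTI setTD => E1.
have n4 : 0 < 4 * n%:R :> R by rewrite mulr_gt0// ltr0n.
have H : (expprob n (~` M) <= (1 / 2)%:E)%E.
  have -> : (1 / 2)%:E = ((4 * n%:R)^-1%:E * (2 * n%:R)%:E :> \bar R)%E.
    by rewrite -EFinM; congr EFin; field; rewrite pnatr_eq0 -lt0n n0.
  rewrite -tsqr_expectation -ge0_integralZl//; first last.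
  - by move=> u _; rewrite lee_fin mulr_ge0 ?tsqr_ge0 ?texpd_ge0.
  - apply/measurable_EFinP; apply: measurable_funM; first exact: measurable_tsqr.
    exact: measurable_texpd.
  apply: ge0_le_integral => //.
  - by move=> u _; rewrite lee_fin mulr_ge0 ?texpd_ge0.
  - by apply: mindic; exact: measurableC.
  - apply/measurable_EFinP; apply: measurable_funM => //.
    by apply: measurable_funM; [exact: measurable_tsqr|exact: measurable_texpd].
  - move=> u _; rewrite lee_fin mulrA ler_wpM2r ?texpd_ge0//.
    rewrite indicE; case: (boolP (u \in _)) => [|_].
      rewrite inE /M/= => /negP; rewrite -ltNge => Mu.
      by rewrite mulrC ler_pdivlMr// mul1r ltW.
    by rewrite mulr_ge0 ?tsqr_ge0// invr_ge0 ltW.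
have fM : expprob n M \is a fin_num.
  by rewrite ge0_fin_numE ?expprob_ge0// (le_lt_trans (expprob_le1 _ _ mM))// ltry.
have fC : expprob n (~` M) \is a fin_num.
  by rewrite ge0_fin_numE ?expprob_ge0// (le_lt_trans H)// ltry.
move: E1 H; rewrite -(fineK fM) -(fineK fC) -EFinD !lee_fin => -[]; lra.
Qed.

(** If all pairs cost more than L, then expR L * \1_X and \1_Y, weighted by the
    exponential density, satisfy the hypothesis of the tensorized inequality,
    whose conclusion contradicts the lower bound on the probabilities. *)
Lemma expprob_concentration n (X Y : set (n.-tuple RT)) (L : R) :
  measurable X -> measurable Y ->
  ((expR (- L))%:E < expprob n X * expprob n Y)%E ->
  exists u v, [/\ X u, Y v & \sum_(i < n) theta (tnth u i - tnth v i) <= L].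
Proof.
move=> mX mY; apply: contraPP => /forallNP nuv.
have {}nuv u v : X u -> Y v -> L < \sum_(i < n) theta (tnth u i - tnth v i).
  move=> Xu Yv; rewrite ltNge; apply/negP => uv.
  by apply: (nuv u); exists v.
apply/negP; rewrite -leNgt expRN -[leRHS]mule1 lee_pdivlMl ?expR_gt0//.
rewrite muleA /expprob -[X in (X * _)%E]ge0_integralZl//; first last.
- by move=> u _; rewrite lee_fin mulr_ge0 ?texpd_ge0.
- exact: mindic.
apply: tuple_coupling_integral_prod_le1.
- by apply: measurable_funeM; exact: mindic.
- exact: mindic.
- by move=> u; rewrite mule_ge0// lee_fin ?expR_ge0// mulr_ge0 ?texpd_ge0.
- by move=> u; rewrite lee_fin mulr_ge0 ?texpd_ge0.
move=> u v; rewrite -!EFinM lee_fin.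
have -> : \prod_(i < n) coupling (tnth u i) (tnth v i) =
  expR (\sum_(i < n) theta (tnth u i - tnth v i)) * (texpd n u * texpd n v).
  rewrite expR_sum -!big_split/=; apply: eq_bigr => i _.
  rewrite /coupling /expd; case: (0 < tnth u i); case: (0 < tnth v i) => /=;
    by rewrite ?mulr0 ?mul0r ?mulr0// -!expRD addrA.
rewrite (_ : _ * _ * _ = expR L * (\1_X u * \1_Y v) * (texpd n u * texpd n v));
  last by ring.
rewrite ler_wpM2r ?mulr_ge0 ?texpd_ge0// !indicE.
case: (boolP (u \in X)) => [|_]; last by rewrite mul0r mulr0 expR_ge0.
case: (boolP (v \in Y)) => [|_]; last by rewrite mulr0 mulr0 expR_ge0.
rewrite !inE => Yv Xu; rewrite !mulr1 ler_expR ltW//; exact: nuv.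
Qed.

End exponential.

(** * Inner approximation of Caratheodory-measurable sets *)

Section inner_regularity.
Context d (T : measurableType d) (R : realType).
Variable mu : {measure set T -> \bar R}.

(** Cover D `\` A from outside by a measurable set, almost optimally, and take
    the complement in D; the Caratheodory condition tested on D says that
    nothing is lost. *)
Lemma caratheodory_inner_approx (A D : set T) (c : R) :
  ((mu^*)%mu).-caratheodory A -> A `<=` D -> measurable D -> (mu D < +oo)%E ->
  (c%:E < (mu^*)%mu A)%E ->
  exists B, [/\ measurable B, B `<=` A & (c%:E < mu B)%E].
Proof.
move=> cA AD mD Dfin cA0.
have ext0 X : (0 <= (mu^*)%mu X)%E by exact: mu_ext_ge0.
have DE := measurable_mu_extE mu mD.
have fin X : X `<=` D -> (mu^*)%mu X \is a fin_num.
  move=> XD; rewrite ge0_fin_numE//; apply: le_lt_trans Dfin.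
  by rewrite -DE; exact: le_mu_ext.
have fA := fin _ AD.
have fDA : (mu^*)%mu (D `&` ~` A) \is a fin_num by apply: fin => x [].
have := cA D; rewrite DE (setIidr AD) => E.
pose e := fine ((mu^*)%mu A) - c.
have e0 : 0 < e by rewrite subr_gt0 -lte_fin fineK.
have [_ [F [mF DAF] <-]] := lb_ereal_inf_adherent e0 fDA.
rewrite -/((mu^*)%mu (D `&` ~` A)) => Flt.
have mU : measurable (\bigcup_k F k) by exact: bigcup_measurable.
exists (D `\` \bigcup_k F k); split.
- exact: measurableD.
- move=> x [Dx nFx]; apply: contrapT => nAx; apply: nFx; exact: DAF.
have mDU : measurable (D `\` \bigcup_k F k) by exact: measurableD.
have UF : (mu (\bigcup_k F k) <= \sum_(k <oo) mu (F k))%E.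
  exact: measure_sigma_subadditive.
have H : (mu D <= mu (D `\` \bigcup_k F k) + mu (\bigcup_k F k))%E.
  apply: le_trans (measureU2 _ mDU mU) => //.
  apply: le_measure; rewrite ?inE//; first exact: measurableU.
  by move=> x Dx; have [?|?] := pselect ((\bigcup_k F k) x); [right|left].
have Ufin : mu (\bigcup_k F k) \is a fin_num.
  rewrite ge0_fin_numE//; apply: le_lt_trans UF _; apply: lt_le_trans Flt _.
  by rewrite -(fineK fDA) -EFinD leey.
have Bfin : mu (D `\` \bigcup_k F k) \is a fin_num.
  rewrite ge0_fin_numE//; apply: le_lt_trans Dfin.
  by apply: le_measure; rewrite ?inE// => x [].
have := le_lt_trans UF Flt; move: H; rewrite E.
rewrite -/((mu^*)%mu (D `&` ~` A)).
rewrite -(fineK fA) -(fineK fDA) -(fineK Ufin) -(fineK Bfin) -!EFinD.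
rewrite lee_fin !lte_fin /e; lra.
Qed.

End inner_regularity.

(** * A determinant identity *)

Section determinant.
Context {R : comNzRingType}.

(** Sylvester's identity, from the two triangular factorizations of the block
    matrix with rows (1, - A) and (B, 1). *)
Lemma det_1D_mulmxC m n (A : 'M[R]_(m, n)) (B : 'M[R]_(n, m)) :
  \det (1%:M + A *m B) = \det (1%:M + B *m A).
Proof.
pose X : 'M[R]_(m + n) := block_mx 1%:M (- A) B 1%:M.
have X1 : X = block_mx 1%:M 0 B 1%:M *m block_mx 1%:M (- A) 0 (1%:M + B *m A).
  rewrite mulmx_block !mul1mx !mulmx1 !mul0mx !addr0 mulmxN.
  by rewrite addrCA addNr addr0.
have X2 : X = block_mx (1%:M + A *m B) (- A) 0 1%:M *m block_mx 1%:M 0 B 1%:M.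
  rewrite mulmx_block !mul1mx !mulmx1 !mul0mx !mulmx0 !add0r mulNmx.
  by rewrite addrK.
have : \det X = \det X by [].
rewrite {1}X2 X1 !det_mulmx !det_ublock !det_lblock !det1.
by rewrite !mulr1 !mul1r.
Qed.

End determinant.

(** * The parametrization of the simplex *)

Section simplex_param.
Context {R : realType}.
Local Notation RT := (measurableTypeR R).
Local Notation param k t :=
  (flat_param (@simplex_vertex R k.+1) (@simplex_frame R k.+1) t).

Lemma param_widen k (t : k.-tuple RT) (i : 'I_k) :
  param k t 0 (widen_ord (leqnSn k) i) = tnth t i.
Proof.
rewrite !mxE/= (ltn_eqF (ltn_ord i)) mulr0 add0r (bigD1 i)//= !mxE/=.
rewrite eqxx (ltn_eqF (ltn_ord i)) subr0 mulr1 big1 ?addr0// => j ji.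
rewrite !mxE/= (ltn_eqF (ltn_ord i)) subr0 (_ : (i == j :> nat) = false) ?mulr0//.
by apply/negbTE; apply: contraNneq ji => /val_inj ->.
Qed.

Lemma param_max k (t : k.-tuple RT) :
  param k t 0 ord_max = omega k.+1 - tsum k t.
Proof.
rewrite !mxE/= eqxx mulr1; congr (_ + _).
rewrite /tsum -sumrN; apply: eq_bigr => i _.
by rewrite !mxE/= eqxx gtn_eqF// sub0r mulrN1.
Qed.

(** The Gram matrix of the edge directions is the identity plus the all-ones
    matrix, a rank-one perturbation. *)
Lemma det_simplex_frame k :
  \det (@simplex_frame R k.+1 *m (@simplex_frame R k.+1)^T) = k.+1%:R.
Proof.
have -> : @simplex_frame R k.+1 *m (@simplex_frame R k.+1)^T =
    1%:M + (const_mx 1 : 'M[R]_(k, 1)) *m (const_mx 1 : 'M[R]_(1, k)).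
  apply/matrixP => i j; rewrite !mxE big_ord1 !mxE big_ord_recr/=.
  rewrite !mxE/= eqxx !gtn_eqF// !sub0r mulrNN mulr1; congr (_ + _).
  rewrite (bigD1 i)//= !mxE/= eqxx !(ltn_eqF (ltn_ord i)) !subr0 mul1r.
  rewrite big1 ?addr0 => [|l li].
    by congr (_%:R).
  rewrite !mxE/= (ltn_eqF (ltn_ord l)) !subr0 (_ : (l == i :> nat) = false) ?mul0r//.
  by apply/negbTE; apply: contraNneq li => /val_inj ->.
rewrite det_1D_mulmxC det_mx11 !mxE.
under eq_bigr do rewrite !mxE mulr1.
by rewrite sumr_const card_ord -[k.+1%:R]natr1 addrC.
Qed.

Lemma omega_gt0 n : (0 < n)%N -> 0 < @omega R n.
Proof.
move=> n0; apply: powR_gt0; rewrite divr_gt0 ?ltr0n ?fact_gt0//.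
by rewrite mulr_gt0 ?sqrtr_gt0 ?ltr0n.
Qed.

(** Together with det_simplex_frame, this says that the unit simplex has volume 1
    once its parameter domain is known to have volume omega ^+ k / k`!. *)
Lemma omega_exp k : (0 < k)%N ->
  @omega R k.+1 ^+ k * Num.sqrt k.+1%:R = k`!%:R.
Proof.
move=> k0; rewrite /omega -powR_mulrn ?powR_ge0// -powRrM mulVf ?pnatr_eq0 -?lt0n//.
have s0 : 0 < Num.sqrt k.+1%:R :> R by rewrite sqrtr_gt0 ltr0n.
rewrite powRr1; last by rewrite divr_ge0// mulr_ge0// ltW.
rewrite factS natrM invfM mulrCA mulrA -[X in _ * X]mulr1.
by field; rewrite gt_eqF//= pnatr_eq0.
Qed.

Lemma omega_le n : (1 < n)%N -> @omega R n <= n%:R.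
Proof.
case: n => [//|k]; rewrite ltnS => k0.
rewrite -(@ler_pXn2r R k)// ?nnegrE ?ler0n ?powR_ge0//.
have s1 : 1 <= Num.sqrt k.+1%:R :> R.
  by rewrite -[leLHS]sqrtr1 ler_wsqrtr// ler1n.
have w0 : 0 <= @omega R k.+1 ^+ k by rewrite exprn_ge0// ltW// omega_gt0.
apply: (@le_trans _ _ (@omega R k.+1 ^+ k * Num.sqrt k.+1%:R)).
  by rewrite ler_peMr.
rewrite omega_exp// -natrX ler_nat.
have : (k <= k.+1)%N by [].
elim: {1 3 5}k => // j IHj jk; rewrite factS expnS leq_mul//.
exact/IHj/ltnW.
Qed.

End simplex_param.

(** * From a small cost to a small distance *)

Section geometry.
Context {R : realType}.
Local Notation RT := (measurableTypeR R).

(** Cauchy-Schwarz against the constant vector, as nonnegativity of the variance. *)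
Lemma sqr_sum_le n (f : 'I_n -> R) : (\sum_i f i) ^+ 2 <= n%:R * \sum_i f i ^+ 2.
Proof.
case: n f => [|n] f; first by rewrite !big_ord0 expr0n mul0r.
set S := \sum_i f i; set T := \sum_i f i ^+ 2.
have n0 : 0 < n.+1%:R :> R by [].
have : 0 <= \sum_i (f i - S / n.+1%:R) ^+ 2 by apply: sumr_ge0 => i _; exact: sqr_ge0.
have -> : \sum_i (f i - S / n.+1%:R) ^+ 2 = T - S ^+ 2 / n.+1%:R.
  under eq_bigr => i _.
    rewrite sqrrB -mulr_natr -mulrA.
    rewrite (_ : f i * _ = f i * (S / n.+1%:R * 2)); last by rewrite mulrA.
    over.
  rewrite big_split/= sumrB -mulr_suml sumr_const card_ord -/T -/S -mulr_natr.
  by field; rewrite gt_eqF.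
by rewrite subr_ge0 ler_pdivrMr// mulrC.
Qed.

Lemma sum_sqr_le n (f : 'I_n -> R) : (forall i, 0 <= f i) ->
  \sum_i f i ^+ 2 <= (\sum_i f i) ^+ 2.
Proof.
move=> f0; rewrite [leRHS]expr2 mulr_suml; apply: ler_sum => i _.
rewrite expr2 ler_wpM2l// (bigD1 i)//= lerDl sumr_ge0//.
Qed.

Lemma theta_sum_sqr n (d : 'I_n -> R) (Q : R) : 0 <= Q ->
  16 * (\sum_i theta (d i)) <= Q -> \sum_i d i ^+ 2 <= Q ^+ 2 + 2 * Q.
Proof.
move=> Q0; rewrite mulr_sumr => dQ.
have e0 i : 0 <= 16 * theta (d i) by rewrite mulr_ge0 ?theta_ge0.
have -> : \sum_i d i ^+ 2 =
    \sum_i (16 * theta (d i)) ^+ 2 + 2 * \sum_i (16 * theta (d i)).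
  rewrite mulr_sumr -big_split/=; apply: eq_bigr => i _.
  have := theta_sqrt (d i); rewrite sqrrD expr1n mulr1.
  by set e := 16 * _; lra.
apply: lerD; last by rewrite ler_pM2l.
apply: (le_trans (sum_sqr_le _ _ e0)).
by rewrite ler_sqr ?nnegrE ?sumr_ge0.
Qed.

(** Each |d i| is at most e i + sqrt (2 * e i) with e i := 16 * theta (d i); the
    square roots are summed by Cauchy-Schwarz. For Q below n this is of order
    n * Q, better than the order n * Q ^+ 2 that theta_sum_sqr would give. *)
Lemma theta_sum_lin n (d : 'I_n -> R) (Q : R) : 0 <= Q ->
  16 * (\sum_i theta (d i)) <= Q ->
  (\sum_i d i) ^+ 2 <= 2 * Q ^+ 2 + 4 * n%:R * Q.
Proof.
move=> Q0; rewrite mulr_sumr => dQ.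
pose e i := 16 * theta (d i); pose f i := Num.sqrt (2 * e i).
have e0 i : 0 <= e i by rewrite mulr_ge0 ?theta_ge0.
have f0 i : 0 <= f i by exact: sqrtr_ge0.
have fE i : f i ^+ 2 = 2 * e i by rewrite sqr_sqrtr// mulr_ge0.
have def i : `|d i| <= e i + f i.
  rewrite -(@ler_pXn2r _ 2)// ?nnegrE ?addr_ge0// real_normK ?num_real//.
  have := theta_sqrt (d i); rewrite -/(e i) sqrrD sqrrD expr1n mulr1 fE => h.
  have := mulr_ge0 (e0 i) (f0 i); lra.
have H : `|\sum_i d i| <= \sum_i e i + \sum_i f i.
  apply: (le_trans (ler_norm_sum _ _ _)); rewrite -big_split/=.
  exact: ler_sum.
have E0 : 0 <= \sum_i e i by exact: sumr_ge0.
have F0 : 0 <= \sum_i f i by exact: sumr_ge0.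
have F2 : (\sum_i f i) ^+ 2 <= n%:R * (2 * Q).
  apply: (le_trans (sqr_sum_le _ _)); rewrite ler_wpM2l//.
  by under eq_bigr do rewrite fE; rewrite -mulr_sumr ler_pM2l.
have E2 : (\sum_i e i) ^+ 2 <= Q ^+ 2 by rewrite ler_sqr ?nnegrE.
have : (\sum_i d i) ^+ 2 <= (\sum_i e i + \sum_i f i) ^+ 2.
  by rewrite -(real_normK (num_real (\sum_i d i))) ler_sqr ?nnegrE ?addr_ge0.
move/le_trans; apply.
move: E2 F2; set E := \sum_i e i; set F := \sum_i f i => E2 F2.
have := sqr_ge0 (E - F); rewrite sqrrB sqrrD; lra.
Qed.

(** With s and s' the coordinate sums of u and v,
    w u / s - w v / s' = (w / s) ((u - v) + ((s' - s) / s') v).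
    The first term is controlled by theta_sum_sqr. In the second one, the
    relative defect (s' - s) / s' has square of order Q / n by theta_sum_lin,
    and v has squared norm of order Q * n. *)
Lemma normalized_dist_le n (u v : n.-tuple RT) (w Q : R) :
  (0 < n)%N -> 0 < w -> w <= n%:R -> 1 <= Q -> Q <= 112 * n%:R ->
  n%:R / 4 <= tsum n u -> n%:R / 4 <= tsum n v ->
  16 * (\sum_i theta (tnth u i - tnth v i)) <= Q ->
  tsqr n v <= 8 * n%:R + 2 * Q ^+ 2 + 4 * Q ->
  \sum_i (w / tsum n u * tnth u i - w / tsum n v * tnth v i) ^+ 2 <=
    (100 * 100 * Q) ^+ 2.
Proof.
move=> n0 w0 wn Q1 Qn; set s := tsum n u; set s' := tsum n v => sn s'n uvQ v2.
have N0 : 0 < n%:R :> R by rewrite ltr0n.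
have Q0 : 0 <= Q by exact: le_trans Q1.
have s0 : 0 < s by apply: lt_le_trans sn; rewrite divr_gt0.
have s'0 : 0 < s' by apply: lt_le_trans s'n; rewrite divr_gt0.
pose d i := tnth u i - tnth v i.
have dsq := theta_sum_sqr n d Q Q0 uvQ.
have dlin := theta_sum_lin n d Q Q0 uvQ.
have dE : \sum_i d i = s - s' by rewrite sumrB.
rewrite dE in dlin.
have ws : w / s <= 4.
  rewrite ler_pdivrMr//; apply: (le_trans wn).
  by move: sn; rewrite ler_pdivrMr// mulrC.
have ws0 : 0 <= w / s by rewrite divr_ge0// ltW.
set r := (s' - s) / s'.
have QN : Q <= Q * n%:R by rewrite ler_peMr// ler1n.
have QQ : Q ^+ 2 <= 112 * (Q * n%:R) by rewrite expr2 mulrCA ler_wpM2l.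
have r2 : r ^+ 2 <= 3648 * Q / n%:R.
  rewrite /r expr_div_n -[(s' - s) ^+ 2]sqrrN opprB ler_pdivrMr ?exprn_gt0//.
  apply: (le_trans dlin); apply: (@le_trans _ _ (228 * (Q * n%:R))); first by lra.
  rewrite [leRHS](_ : _ = (228 * Q) * (16 * s' ^+ 2 / n%:R)); last by ring.
  rewrite mulrA ler_wpM2l ?mulr_ge0// ler_pdivlMr// -expr2.
  have : (n%:R / 4) ^+ 2 <= s' ^+ 2.
    by rewrite ler_sqr ?nnegrE// ?(ltW s'0)// divr_ge0.
  by rewrite expr_div_n; lra.
have key i : (w / s * tnth u i - w / s' * tnth v i) ^+ 2 <=
    32 * (d i ^+ 2 + r ^+ 2 * tnth v i ^+ 2).
  have -> : w / s * tnth u i - w / s' * tnth v i = w / s * (d i + r * tnth v i).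
    by rewrite /d /r; field; rewrite !gt_eqF.
  rewrite exprMn.
  have W2 : (w / s) ^+ 2 <= 16.
    by rewrite (_ : 16 = 4 ^+ 2); [rewrite ler_sqr ?nnegrE|ring].
  have H : (d i + r * tnth v i) ^+ 2 <= 2 * (d i ^+ 2 + r ^+ 2 * tnth v i ^+ 2).
    rewrite -exprMn; move: (d i) (r * _) => x y; have := sqr_ge0 (x - y).
    by rewrite sqrrB sqrrD; lra.
  apply: (le_trans (ler_pM (sqr_ge0 _) (sqr_ge0 _) W2 H)).
  by rewrite mulrA (_ : 16 * 2 = 32); [|ring].
apply: le_trans; first by apply: ler_sum => i _; exact: key.
rewrite -mulr_sumr big_split/= -mulr_sumr -/(tsqr n v).
set V := tsqr n v in v2 *.
have V0 : 0 <= V by exact: tsqr_ge0.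
have VN : V <= 680 * (Q * n%:R).
  apply: (le_trans v2).
  have : n%:R <= Q * n%:R by rewrite ler_peMl.
  by lra.
have rV : r ^+ 2 * V <= 3648 * 680 * Q ^+ 2.
  apply: (le_trans (ler_pM (sqr_ge0 _) V0 r2 VN)).
  by rewrite le_eqVlt; apply/orP; left; apply/eqP; field; rewrite gt_eqF.
have Q2 : Q <= Q ^+ 2 by rewrite expr2 ler_peMl.
apply: (@le_trans _ _ (32 * (3 * Q ^+ 2 + 3648 * 680 * Q ^+ 2))).
  by rewrite ler_pM2l// lerD//; apply: (le_trans dsq); lra.
rewrite (_ : (100 * 100 * Q) ^+ 2 = 100 * 100 * 100 * 100 * Q ^+ 2); last by ring.
by have := sqr_ge0 Q; lra.
Qed.

End geometry.

(** * The cone over a body *)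

Section body_cone.
Context {R : realType}.
Local Notation mu := (@lebesgue_measure R).
Local Notation RT := (measurableTypeR R).
Local Notation param k t :=
  (flat_param (@simplex_vertex R k.+1) (@simplex_frame R k.+1) t).

Lemma tnth_beheadS k (u : k.+1.-tuple RT) (i : 'I_k) :
  tnth [tuple of behead u] i = tnth u (lift ord0 i).
Proof. by rewrite [in RHS](tuple_eta u) tnthS. Qed.

Lemma tsum_behead k (u : k.+1.-tuple RT) :
  tsum k.+1 u = tnth u ord0 + tsum k [tuple of behead u].
Proof.
rewrite /tsum big_ord_recl; congr (_ + _); apply: eq_bigr => i _.
by rewrite tnth_beheadS.
Qed.

Lemma tsum_tscale k (c : R) (t : k.-tuple RT) :
  tsum k (tscale k c t) = c * tsum k t.
Proof. by rewrite /tsum mulr_sumr; apply: eq_bigr => i _; rewrite tnth_tscale. Qed.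

(** The point of the simplex on the ray through u, up to a cyclic shift of the
    coordinates. *)
Definition cone_point k (u : k.+1.-tuple RT) : 'rV[R]_k.+1 :=
  param k (tscale k (omega k.+1 / tsum k.+1 u) [tuple of behead u]).

(** The coordinates of cone_point k u are those of u, scaled to have sum omega
    and cyclically shifted, hence the same distance. *)
Lemma cone_point_dist k (u v : k.+1.-tuple RT) :
  tsum k.+1 u != 0 -> tsum k.+1 v != 0 ->
  eucl_norm (cone_point k u - cone_point k v) =
  Num.sqrt (\sum_i (omega k.+1 / tsum k.+1 u * tnth u i -
                    omega k.+1 / tsum k.+1 v * tnth v i) ^+ 2).
Proof.
move=> u0 v0; rewrite /eucl_norm; congr Num.sqrt.
have last_coord (t : k.+1.-tuple RT) : tsum k.+1 t != 0 ->
    cone_point k t 0 ord_max = omega k.+1 / tsum k.+1 t * tnth t ord0.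
  move=> t0; rewrite param_max tsum_tscale.
  have := tsum_behead k t; set S := tsum k _ => E.
  have -> : S = tsum k.+1 t - tnth t ord0 by rewrite E addrC addKr.
  by field.
have subE (x y : 'rV[R]_k.+1) j : (x - y) 0 j = x 0 j - y 0 j by rewrite !mxE.
rewrite big_ord_recr big_ord_recl/= addrC; congr (_ + _).
  by rewrite -!last_coord// subE.
have coord (t : k.+1.-tuple RT) (i : 'I_k) :
    cone_point k t 0 (widen_ord (leqnSn k) i) =
    omega k.+1 / tsum k.+1 t * tnth t (lift ord0 i).
  by rewrite /cone_point param_widen tnth_tscale tnth_beheadS.
by apply: eq_bigr => i _; rewrite -!coord subE.
Qed.

(** Positivity of all coordinates is encoded by that of the exponential density,
    which makes the set visibly measurable. *)
Definition open_simplex k (w : R) : set (k.-tuple RT) :=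
  [set t | 0 < texpd k t /\ tsum k t < w].

Lemma texpd_gt0 n (u : n.-tuple RT) :
  0 < texpd n u <-> forall i, 0 < tnth u i.
Proof.
split=> [u0 i|u0]; last by rewrite texpd_gt0E// expR_gt0.
rewrite ltNge; apply/negP => ui; move: u0.
by rewrite /texpd (bigD1 i)//= {1}/expd [0 < tnth u i]ltNge ui/= mul0r ltxx.
Qed.

Lemma measurable_open_simplex k w : measurable (open_simplex k w).
Proof.
have -> : open_simplex k w = texpd k @^-1` `]0, +oo[%classic `&`
    tsum k @^-1` `]-oo, w[%classic.
  by apply/seteqP; split => t /=; rewrite !in_itv/= andbT.
apply: measurableI.
  by rewrite -[X in measurable X]setTI; exact: measurable_texpd.
by rewrite -[X in measurable X]setTI; exact: measurable_tsum.
Qed.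

Lemma tcone_gt0 k (a w : R) (A : set (k.-tuple RT)) u : 0 < a -> 0 < w ->
  A `<=` open_simplex k w -> tcone k a w A u -> forall i, 0 < tnth u i.
Proof.
move=> a0 w0 AD [au /AD[/texpd_gt0 tpos]].
have s0 : 0 < tsum k.+1 u by exact: lt_le_trans au.
rewrite tsum_tscale mulrAC ltr_pdivrMr// ltr_pM2l// => tlt i.
have [->|[j ->]] : i = ord0 \/ exists j, i = lift ord0 j.
  by case: (unliftP ord0 i) => [j ->|->]; [right; exists j|left].
- by move: tlt; rewrite tsum_behead ltrDr.
- by have := tpos j; rewrite tnth_tscale tnth_beheadS pmulr_rgt0// divr_gt0.
Qed.

Lemma tcone_expprob k (a w : R) (A : set (k.-tuple RT)) : 0 < a -> 0 < w ->
  measurable A -> A `<=` open_simplex k w ->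
  expprob k.+1 (tcone k a w A) =
  ((w^-1 ^+ k)%:E * \int[mu]_(s in `[a, +oo[) (s ^+ k * expR (- s))%:E *
   @lebesgue_tuple R k A)%E.
Proof.
move=> a0 w0 mA AD; have := tcone_integral k a w A a0 w0 mA.
rewrite -[X in X = _ -> _](_ : expprob k.+1 (tcone k a w A) = _) => [->|].
  congr (_ * _)%E; rewrite -ge0_integralZl//.
  - apply: eq_integral => s _; rewrite -EFinM; congr EFin.
    by rewrite exprMn; ring.
  - apply/measurable_EFinP; apply: measurable_funTS; apply: measurable_funM => //.
    by apply: measurableT_comp => //; exact: measurable_expR.
  - move=> s /=; rewrite in_itv/= andbT => as_.
    by rewrite lee_fin mulr_ge0 ?expR_ge0// exprn_ge0// (le_trans (ltW a0)).
  - by rewrite lee_fin exprn_ge0// invr_ge0 ltW.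
apply: eq_integral => u _; congr EFin; rewrite indicE.
case: (boolP (u \in _)) => [|_]; last by rewrite !mul0r.
by rewrite inE => /(tcone_gt0 _ _ _ _ _ a0 w0 AD) u0; rewrite texpd_gt0E.
Qed.

(** The radial factor is at least 3/4 of the full Gamma integral k`!, as the
    coordinate sum exceeds (k + 1) / 4 with that probability at least. *)
Lemma tcone_expprob_ge k (w : R) (A : set (k.-tuple RT)) : 0 < w ->
  measurable A -> A `<=` open_simplex k w ->
  ((w^-1 ^+ k * (k`!%:R * (3 / 4)))%:E * @lebesgue_tuple R k A <=
  expprob k.+1 (tcone k (k.+1%:R / 4) w A))%E.
Proof.
move=> w0 mA AD; have a0 : 0 < k.+1%:R / 4 :> R by rewrite divr_gt0.
rewrite tcone_expprob// lee_wpmul2r// EFinM lee_wpmul2l//.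
  by rewrite lee_fin exprn_ge0// invr_ge0 ltW.
have := gamma_tail_ge k (k.+1%:R / 4) (ltW a0).
apply: le_trans; rewrite lee_fin ler_wpM2l// mulrAC divff ?pnatr_eq0//; lra.
Qed.

(** A cone over a set of infinite measure would have infinite probability. *)
Lemma open_simplex_finite k (w : R) : 0 < w ->
  (@lebesgue_tuple R k (open_simplex k w) < +oo)%E.
Proof.
move=> w0; rewrite ltey; apply/eqP => E.
have mD := measurable_open_simplex k w.
have := tcone_expprob_ge k w _ w0 mD (@subset_refl _ _).
rewrite E gt0_muley ?lte_fin; last first.
  by rewrite !mulr_gt0 ?exprn_gt0 ?invr_gt0 ?ltr0n ?fact_gt0.
rewrite leye_eq => /eqP E1.
have := expprob_le1 k.+1 (tcone k (k.+1%:R / 4) w (open_simplex k w))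
  (measurable_tcone _ _ _ _ (divr_gt0 (ltr0Sn _ _) (ltr0Sn _ _)) mD).
by rewrite E1.
Qed.

Lemma body_param_sub k (A : set 'rV[R]_k.+1) : (0 < k)%N ->
  A `<=` unit_simplex k.+1 ->
  flat_param (@simplex_vertex R k.+1) (@simplex_frame R k.+1) @^-1` A
    `<=` open_simplex k (omega k.+1).
Proof.
move=> k0 AD t /AD[z [zpos zsum] E].
have w0 : 0 < @omega R k.+1 by exact: omega_gt0.
have pos i : 0 < param k t 0 i by rewrite -E mxE mulr_gt0.
split; first by apply/texpd_gt0 => i; rewrite -param_widen.
by have := pos ord_max; rewrite param_max subr_gt0.
Qed.

(** The volume eps of A is sqrt (k + 1) times its parametric volume, and
    omega ^+ k * sqrt (k + 1) = k`!, so the cone over A has probability at least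
    3 / 4 * eps. Half of it may be lost in passing to a Borel subset. *)
Lemma body_cone k (eps : R) (A : set 'rV[R]_k.+1) : (0 < k)%N -> 0 < eps ->
  body A -> volume A = eps%:E ->
  exists X : set (k.+1.-tuple RT), [/\ measurable X,
    ((eps / 4)%:E < expprob k.+1 X)%E,
    forall u, X u -> k.+1%:R / 4 <= tsum k.+1 u &
    forall u, X u -> A (cone_point k u)].
Proof.
move=> k0 eps0 [Asub cA] volA.
set w := @omega R k.+1.
have w0 : 0 < w by exact: omega_gt0.
have sub := body_param_sub k A k0 Asub.
set At := _ @^-1` A in sub.
have sq0 : 0 < Num.sqrt k.+1%:R :> R by rewrite sqrtr_gt0.
have outer : lebesgue_outer k At = (eps / Num.sqrt k.+1%:R)%:E.
  move: volA; rewrite /volume /flat_volume det_simplex_frame => volA.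
  have : ((Num.sqrt k.+1%:R)^-1%:E * ((Num.sqrt k.+1%:R)%:E * lebesgue_outer k At) =
    (Num.sqrt k.+1%:R)^-1%:E * eps%:E)%E by congr (_ * _)%E.
  by rewrite muleA -!EFinM mulVf ?gt_eqF// mul1e => ->; rewrite mulrC.
have [|B [mB BA Bvol]] := @caratheodory_inner_approx _ _ _ (@lebesgue_tuple R k)
    At (open_simplex k w) (eps / Num.sqrt k.+1%:R / 2) cA sub
    (measurable_open_simplex k w) (open_simplex_finite k w w0).
  rewrite -/(lebesgue_outer k At) outer lte_fin gtr_pMr ?divr_gt0//.
  by rewrite invf_lt1// ltr1n.
have BD : B `<=` open_simplex k w by exact: subset_trans sub.
have a0 : 0 < k.+1%:R / 4 :> R by rewrite divr_gt0.
exists (tcone k (k.+1%:R / 4) w B); split.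
- exact: measurable_tcone.
- apply: lt_le_trans (tcone_expprob_ge k w B w0 mB BD).
  set c := w^-1 ^+ k * _.
  have c0 : 0 < c by rewrite !mulr_gt0 ?exprn_gt0 ?invr_gt0 ?ltr0n ?fact_gt0.
  apply: (@le_lt_trans _ _ (c%:E * (eps / Num.sqrt k.+1%:R / 2)%:E)%E); last first.
    by rewrite lte_pmul2l// fin_numE.
  rewrite -EFinM lee_fin.
  have -> : c * (eps / Num.sqrt k.+1%:R / 2) = 3 / 8 * eps.
    rewrite /c -(omega_exp k k0) -/w exprVn; field.
    by rewrite !gt_eqF// exprn_gt0.
  lra.
- by move=> u [].
- by move=> u [_ /BA].
Qed.

End body_cone.

(** * Distance between two bodies *)

Section distance.
Context {R : realType}.
Local Notation RT := (measurableTypeR R).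

Lemma eucl_dist_le n (A B : set 'rV[R]_n) x y : A x -> B y ->
  eucl_dist A B <= eucl_norm (x - y).
Proof.
move=> Ax By; apply: ge_inf; last by exists x => //; exists y.
by exists 0 => _ [a _ [b _ <-]]; exact: sqrtr_ge0.
Qed.

(** Disposes of the volumes so small that - ln eps exceeds the dimension. *)
Lemma unit_simplex_diam n (x y : 'rV[R]_n) : (0 < n)%N ->
  unit_simplex n x -> unit_simplex n y -> eucl_norm (x - y) <= 2 * omega n.
Proof.
move=> n0 [a [a0 a1] <-] [b [b0 b1] <-].
have w0 : 0 < @omega R n by exact: omega_gt0.
have sq_le1 (z : 'rV[R]_n) : (forall i, 0 < z 0 i) -> \sum_i z 0 i = 1 ->
    \sum_i z 0 i ^+ 2 <= 1.
  move=> z0 z1; apply: (le_trans (sum_sqr_le _ _ _)) => [i|].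
    exact: ltW.
  by rewrite z1 expr1n.
have w2 : 0 <= 2 * @omega R n by rewrite mulr_ge0// ltW.
rewrite /eucl_norm -[leRHS]ger0_norm// -sqrtr_sqr ler_wsqrtr//.
apply: (@le_trans _ _ (\sum_i omega n ^+ 2 * (a 0 i ^+ 2 + b 0 i ^+ 2))).
  apply: ler_sum => i _; rewrite !mxE -mulrBr exprMn ler_wpM2l ?sqr_ge0//.
  have := mulr_gt0 (a0 i) (b0 i); rewrite sqrrB -mulr_natr; lra.
rewrite -mulr_sumr exprMn mulrC ler_pM2r ?exprn_gt0// big_split/=.
by have := sq_le1 _ a0 a1; have := sq_le1 _ b0 b1; lra.
Qed.

(** Write L := - ln eps. Two cones of probability at least a power of eps contain
    u and v of cost at most 7 * L. When L is below the dimension the norm of v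
    must also be of the right order; this is ensured by discarding from the
    second cone the vectors of squared norm above beta. That loses at most half
    of the probability: otherwise the discarded part would contain a vector at
    cost at most 7 * L from some vector of squared norm at most 4 * n, and beta
    is too large for this. *)
Lemma body_pair_le k (eps : R) (A B : set 'rV[R]_k.+1) : (0 < k)%N ->
  0 < eps -> eps < 1 / 2 -> body A -> body B ->
  volume A = eps%:E -> volume B = eps%:E ->
  exists x y, [/\ A x, B y &
    eucl_norm (x - y) <= 100 * 100 * (112 * - ln eps)].
Proof.
move=> k0 eps0 eps12 bA bB vA vB.
set L := - ln eps.
have epsE : eps = expR (- L) by rewrite opprK lnK.
have L12 : 1 / 2 <= L.
  rewrite leNgt; apply/negP => L1; move: eps12; rewrite epsE ltNge => /negP; apply.
  apply: le_trans (expR_ge1Dx _); lra.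
have exp7 : expR (- (7 * L)) = eps ^+ 7.
  by rewrite -mulrN expRM_natl -epsE.
(* The room that eps < 1 / 2 leaves for absorbing constants into powers of
   eps: the probabilities below have product at least eps ^+ 2 / 32. *)
have eps5 : eps ^+ 5 < 1 / 32.
  have : eps ^+ 5 < (1 / 2) ^+ 5 by rewrite ltr_pXn2r// nnegrE ?ltW.
  by move/lt_le_trans; apply; rewrite expr_div_n expr1n; lra.
have [X [mX PX Xsum XA]] := body_cone k eps A k0 eps0 bA vA.
have [Y [mY PY Ysum YB]] := body_cone k eps B k0 eps0 bB vB.
have [n_le|L_lt] := leP (k.+1%:R) L.
  have [u [v [Xu Yv _]]] : exists u v, [/\ X u, Y v &
      \sum_(i < k.+1) theta (tnth u i - tnth v i) <= 7 * L].
    apply: expprob_concentration => //; rewrite exp7.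
    apply: lt_trans (lte_pmul _ _ PX PY); rewrite ?lee_fin ?divr_ge0 ?(ltW eps0)//.
    rewrite -EFinM lte_fin.
    rewrite (_ : 7 = 5 + 2)%N// exprD.
    have e2 : 0 < eps ^+ 2 by rewrite exprn_gt0.
    rewrite (_ : eps / 4 * (eps / 4) = 1 / 16 * eps ^+ 2); last by field.
    by rewrite ltr_pM2r//; lra.
  exists (cone_point k u), (cone_point k v); split; [exact: XA|exact: YB|].
  have sA := bA.1 _ (XA _ Xu); have sB := bB.1 _ (YB _ Yv).
  apply: (le_trans (unit_simplex_diam _ _ _ _ sA sB)) => //.
  have := @omega_le R k.+1 k0; lra.
(* 112 = 16 * 7 absorbs the normalization of theta in the cost bound 7 * L. *)
set Q := 112 * L.
have Q0 : 0 <= Q by rewrite /Q; lra.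
have costQ (S : R) : S <= 7 * L -> 16 * S <= Q by rewrite /Q; lra.
pose beta : R := 8 * k.+1%:R + 2 * Q ^+ 2 + 4 * Q.
pose T : set (k.+1.-tuple RT) := [set v | tsqr k.+1 v <= beta].
have mT : measurable T by exact: measurable_tsqr_le.
have mYT : measurable (Y `&` T) by exact: measurableI.
have mYD : measurable (Y `\` T) by exact: measurableD.
have PYT : ((eps / 8)%:E < expprob k.+1 (Y `&` T))%E.
  rewrite ltNge; apply/negP => PYT.
  have PYD : ((eps / 8)%:E < expprob k.+1 (Y `\` T))%E.
    rewrite ltNge; apply/negP => PYD.
    have := expprob_split _ _ _ mY mT => E.
    have := leeD PYT PYD; rewrite -E -EFinD leNgt => /negP; apply.
    by apply: le_lt_trans PY; rewrite lee_fin; lra.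
  have mM := measurable_tsqr_le k.+1 (4 * k.+1%:R).
  have [u [v [Mu [Yv nTv] uv]]] : exists u v, [/\
      [set u : k.+1.-tuple RT | tsqr k.+1 u <= 4 * k.+1%:R] u, (Y `\` T) v &
      \sum_(i < k.+1) theta (tnth u i - tnth v i) <= 7 * L].
    apply: expprob_concentration => //; rewrite exp7.
    have PM := @expprob_tsqr R k.+1 isT.
    apply: (@lt_le_trans _ _ ((1 / 2)%:E * (eps / 8)%:E)%E).
      rewrite -EFinM lte_fin.
      have e5 : 0 < eps ^+ 2 by rewrite exprn_gt0.
      have -> : eps ^+ 7 = eps ^+ 5 * (eps * eps) by ring.
      have : eps ^+ 5 * (eps * eps) < 1 / 32 * (eps * eps).
        by rewrite ltr_pM2r// mulr_gt0.
      by move/lt_le_trans; apply; nra.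
    apply: lee_pmul => //; rewrite ?lee_fin ?divr_ge0 ?(ltW eps0)//.
    exact: ltW.
  apply: nTv; rewrite /T/=.
  have := theta_sum_sqr k.+1 _ Q Q0 (costQ _ uv) => dsq.
  have : tsqr k.+1 v <= 2 * tsqr k.+1 u + 2 * \sum_i (tnth u i - tnth v i) ^+ 2.
    rewrite /tsqr !mulr_sumr -big_split/=; apply: ler_sum => i _.
    move: (tnth u i : R) (tnth v i : R) => a b.
    have := sqr_ge0 (2 * a - b); rewrite !sqrrB exprMn; lra.
  move: Mu => /=; rewrite /beta; lra.
have [u [v [Xu [Yv Tv] uv]]] : exists u v, [/\ X u, (Y `&` T) v &
    \sum_(i < k.+1) theta (tnth u i - tnth v i) <= 7 * L].
  apply: expprob_concentration => //; rewrite exp7.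
  apply: lt_trans (lte_pmul _ _ PX PYT); rewrite ?lee_fin ?divr_ge0 ?(ltW eps0)//.
  rewrite -EFinM lte_fin.
  have e2 : 0 < eps ^+ 2 by rewrite exprn_gt0.
  have -> : eps ^+ 7 = eps ^+ 5 * eps ^+ 2 by ring.
  rewrite (_ : eps / 4 * (eps / 8) = 1 / 32 * eps ^+ 2); last by field.
  by rewrite ltr_pM2r.
have n0 : 0 < k.+1%:R :> R by [].
have su : 0 < tsum k.+1 u by apply: lt_le_trans (Xsum _ Xu); rewrite divr_gt0.
have sv : 0 < tsum k.+1 v by apply: lt_le_trans (Ysum _ Yv); rewrite divr_gt0.
exists (cone_point k u), (cone_point k v); split; [exact: XA|exact: YB|].
rewrite cone_point_dist ?gt_eqF//.
have Q1 : 0 <= 100 * 100 * Q by rewrite mulr_ge0.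
rewrite -[leRHS]ger0_norm// -sqrtr_sqr ler_wsqrtr//.
apply: normalized_dist_le => //.
- exact: omega_gt0.
- exact: omega_le.
- by rewrite /Q; lra.
- by rewrite /Q ler_pM2l// ltW.
- exact: Xsum.
- exact: Ysum.
- exact: costQ.
Qed.

End distance.

Theorem theorem5p5 (R : realType) :
  exists c : R, 0 < c /\
    forall (n : nat) (eps : R) (A B : set 'rV[R]_n),
      (2 <= n)%N -> 0 < eps -> eps < 1 / 2 ->
      body A -> body B ->
      volume A = eps%:E -> volume B = eps%:E ->
      eucl_dist A B <= - c * ln eps.
Proof.
exists (100 * 100 * 112); split; first by rewrite !mulr_gt0.
move=> [//|k] eps A B k0 eps0 eps12 bA bB vA vB.
have [x [y [Ax By xy]]] := body_pair_le k eps A B k0 eps0 eps12 bA bB vA vB.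
apply: (le_trans (eucl_dist_le _ _ _ _ _ Ax By)).
by apply: (le_trans xy); lra.
Qed.
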